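(* Let $\mathfrak X_0$ be an integral normal scheme with countable function field $K_0$ and let $C$ be an algebraically closed field with a valuation $|\ |$ and the corresponding topology. With the spaces defined in the context, the canonical $\mathbb R^{>0}$-equivariant maps (induced by $(P,u)\mapsto[P,u]$) $$\dot{\mathfrak X}(C)_{\mathbb Q,in}\times\mathbb R^{>0}\ \amalg\coprod_{p\in\mathrm{char}\,\mathfrak X_0}\dot{\mathfrak X}(C)_{p,in}\times_{p^{\mathbb Z}}\mathbb R^{>0}\longrightarrow X=\check{\mathfrak X}(C)_{\mathcal E_{\mathrm{tors}}}\times_{\mathbb Q_0^{>0}}\mathbb R^{>0}$$ and $$\dot{\mathfrak X}_0(C)_{\mathbb Q,in}\times\mathbb R^{>0}\ \amalg\coprod_{p\in\mathrm{char}\,\mathfrak X_0}\dot{\mathfrak X}_0(C)_{p,in}\times_{p^{\mathbb Z}}\mathbb R^{>0}\longrightarrow X_0=\check{\mathfrak X}_0(C)_{\mathcal E_{\mathrm{tors}}}\times_{\mathbb Q_0^{>0}}\mathbb R^{>0}$$ are continuous bijections.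
   Context: Valuations may be archimedean (e.g. $C$ the complex numbers with the usual absolute value). Let $K$ be an algebraic closure of $K_0$, $\pi:\mathfrak X\to\mathfrak X_0$ the normalization of $\mathfrak X_0$ in $K$, $G=\mathrm{Aut}_{K_0}(K)$, acting on $\mathfrak X$ from the right over $\mathfrak X_0$ (with induced isomorphisms $\sigma:\kappa(x^\sigma)\to\kappa(x)$). $\mathcal N_0$ is the submonoid of the multiplicative monoid of positive integers generated by a set $\mathrm{char}\,\mathcal N_0$ of primes containing the set $\mathrm{char}\,\mathfrak X_0$ of positive residue characteristics of $\mathfrak X_0$; $\mathbb Q_0^{>0}\subset\mathbb Q^{>0}$ is the subgroup generated by $\mathcal N_0$. $\dot{\mathfrak X}(C)$ is the set of pairs $(x,\bar P^\times)$, $x\in\mathfrak X$, $\bar P^\times:\kappa(x)^\times\to C^\times$ a group homomorphism, with $(x,\bar P^\times)^\sigma=(x^\sigma,\bar P^\times\circ\sigma)$ for $\sigma\in G$ and injective maps $F_\nu(x,\bar P^\times)=(x,\bar P^\times\circ(\ )^\nu)$. $\dot{\mathfrak X}_0(C)=\dot{\mathfrak X}(C)/G$. $\dot{\mathfrak X}(C)_{\mathcal E_{\mathrm{tors}}}$ is the subset where $(\ker\bar P^\times)_{\mathrm{tors}}$ is finite of order in $\mathcal N_0$. $\check{\mathfrak X}(C)=\mathrm{colim}_{\mathcal N_0}\dot{\mathfrak X}(C)$ (over $\mathcal N_0$ ordered by divisibility, transition map from index $\nu$ to $\nu\mu$ being $F_\mu$), on which the $F_\nu$ become bijective and give a $\mathbb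 Q_0^{>0}$-action; its points are $F_\nu^{-1}P$. $\check{\mathfrak X}(C)_{\mathcal E_{\mathrm{tors}}}=\mathrm{colim}_{\mathcal N_0}\dot{\mathfrak X}(C)_{\mathcal E_{\mathrm{tors}}}$ and $\check{\mathfrak X}_0(C)_{\mathcal E_{\mathrm{tors}}}=\check{\mathfrak X}(C)_{\mathcal E_{\mathrm{tors}}}/G$. $\dot{\mathfrak X}(C)_{in}=\{(x,\bar P^\times)\mid\bar P^\times|_{\mu(\kappa(x))}\text{ injective}\}$; $\dot{\mathfrak X}(C)_{p,in}$, resp. $\dot{\mathfrak X}(C)_{\mathbb Q,in}$, is its subset where $\mathrm{char}\,\kappa(x)=p$, resp. $0$; $\dot{\mathfrak X}_0(C)_{p,in}$ and $\dot{\mathfrak X}_0(C)_{\mathbb Q,in}$ are the quotients by $G$. For $p\in\mathrm{char}\,\mathfrak X_0$ the map $F_p$ is a homeomorphism of $\dot{\mathfrak X}(C)_{p,in}$ and of $\dot{\mathfrak X}_0(C)_{p,in}$, and $p^{\mathbb Z}$ acts with $p$ acting by $F_p$. For a group $Q\subset\mathbb R^{>0}$ acting on a space $M$ (via $q\mapsto F_q$), $M\times_Q\mathbb R^{>0}$ is the quotient of $M\times\mathbb R^{>0}$ by $(m,u)q=(F_q(m),q^{-1}u)$, with the quotient topology; classes are denoted $[m,u]$ and $\mathbb R^{>0}$ acts by $[m,u]v=[m,uv]$. Topologies: if $\mathfrak X_0=\mathrm{Spec}\,R_0$ is affine, $\mathfrak X=\mathrm{Spec}\,R$, identify $(x,\bar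 P^\times)$, $x$ corresponding to the prime $\mathfrak p$, with the multiplicative map $P:R\to C$, $P(r)=\bar P^\times(r\bmod\mathfrak p)$ for $r\notin\mathfrak p$ and $P(r)=0$ for $r\in\mathfrak p$, and give $\dot{\mathfrak X}(C)$ the topology of pointwise convergence. In general $O\subset\dot{\mathfrak X}(C)$ is open iff its intersection with $\dot{\mathfrak X}'(C)=\{(x,\bar P^\times)\mid x\in\pi^{-1}(\mathfrak X_0')\}$ is open there for every affine open $\mathfrak X_0'\subset\mathfrak X_0$. $\check{\mathfrak X}(C)$ has the inductive limit topology ($Z$ is open iff $F_\nu(Z)\cap\dot{\mathfrak X}(C)$ is open in $\dot{\mathfrak X}(C)$ for all $\nu\in\mathcal N_0$), subsets have subspace topologies and quotients by $G$ quotient topologies. *)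

(* Defs.v *)
From HB Require Import structures.
From mathcomp Require Import all_boot all_order all_algebra.
From mathcomp Require Import cyclic finmap generic_quotient ring_quotient.
From mathcomp Require Import all_classical reals topology.

Set Implicit Arguments.
Unset Strict Implicit.
Unset Printing Implicit Defensive.
Import Order.TTheory GRing.Theory Num.Theory.
Import numFieldTopology.Exports.
Local Open Scope classical_set_scope.
Local Open Scope ring_scope.
Local Open Scope quotient_scope.

Record opens (X : topologicalType) := Opens {
  opens_set :> set X;
  opens_open : open opens_set }.

Definition opensI (X : topologicalType) (U V : opens X) : opens X :=
  Opens (openI (opens_open U) (opens_open V)).

Record ringed_space := RingedSpace {
  space :> topologicalType;
  sect : opens space -> comPzRingType;
  res : forall U V : opens space, V `<=` U -> {rmorphism sect U -> sect V};
  res_id : forall (U : opens space) (h : U `<=` U) s, res h s = s;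
  res_comp : forall (U V W : opens space) (hUV : V `<=` U) (hVW : W `<=` V)
    (hUW : W `<=` U) s, res hVW (res hUV s) = res hUW s;
  sheaf_locality : forall (U : opens space) (I : Type) (V : I -> opens space)
      (hV : forall i, V i `<=` U),
    U `<=` \bigcup_i V i ->
    forall s, (forall i, res (hV i) s = 0) -> s = 0;
  sheaf_gluing : forall (U : opens space) (I : Type) (V : I -> opens space)
      (hV : forall i, V i `<=` U),
    U `<=` \bigcup_i V i ->
    forall t : (forall i, sect (V i)),
      (forall i j (hi : opensI (V i) (V j) `<=` V i)
         (hj : opensI (V i) (V j) `<=` V j), res hi (t i) = res hj (t j)) ->
      exists s, forall i, res (hV i) s = t i }.

Section Affine.
Variables (X : ringed_space) (U : opens X).

Definition invertible_at (f : sect U) (x : X) : Prop :=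
  exists (V : opens X) (h : V `<=` U), opens_set V x /\ exists t, res h f * t = 1.

Definition principal_open (f : sect U) : set X :=
  [set x | opens_set U x /\ invertible_at f x].

Definition vanishing_at (x : X) : set (sect U) :=
  [set f | ~ invertible_at f x].

Definition is_prime_ideal (A : comPzRingType) (I : set A) : Prop :=
  [/\ I 0, forall a b, I a -> I b -> I (a + b), forall a b, I b -> I (a * b),
      ~ I 1 & forall a b, I (a * b) -> I a \/ I b].

(* B is the localization A_f along rho *)
Definition is_localization_at (A B : comPzRingType) (rho : A -> B) (f : A) :=
  [/\ exists t, rho f * t = 1,
      forall b, exists n a, b * rho f ^+ n = rho a &
      forall a, rho a = 0 -> exists n, a * f ^+ n = 0].

(* (U, O|_U) is isomorphic to Spec of A = O(U): x |-> vanishing_at x is a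
   homeomorphism from U onto Spec A, and O(D(f)) = A_f for every f in A. *)
Definition affine_open : Prop :=
  [/\ forall x, opens_set U x -> is_prime_ideal (vanishing_at x),
      forall P : set (sect U), is_prime_ideal P ->
        exists! x, opens_set U x /\ vanishing_at x = P,
      forall (V : opens X) x, V `<=` U -> opens_set V x ->
        exists f, principal_open f x /\ principal_open f `<=` V &
      forall (f : sect U) (D : opens X) (h : D `<=` U),
        opens_set D = principal_open f -> is_localization_at (res h) f].

End Affine.

Definition is_scheme (X : ringed_space) : Prop :=
  forall x : X, exists U : opens X, opens_set U x /\ affine_open U.

Definition is_integral (X : ringed_space) : Prop :=
  [set: X] !=set0 /\
  forall U : opens X, U !=set0 ->
    (1 : sect U) <> 0 /\ forall s t : sect U, s * t = 0 -> s = 0 \/ t = 0.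

(* K0 is the function field of X: the stalk at the generic point, that is, the
   colimit of the rings O(U) over the nonempty open sets U. *)
Record function_field (X : ringed_space) (K0 : fieldType) := FunctionField {
  germ : forall U : opens X, U !=set0 -> {rmorphism sect U -> K0};
  germ_res : forall (U V : opens X) (hU : U !=set0) (hV : V !=set0)
    (h : V `<=` U) s, germ hV (res h s) = germ hU s;
  germ_surj : forall a, exists (U : opens X) (hU : U !=set0) s, germ hU s = a;
  germ_eq0 : forall (U : opens X) (hU : U !=set0) s, germ hU s = 0 ->
    exists (V : opens X) (h : V `<=` U), V !=set0 /\ res h s = 0 }.

Record subring (F : fieldType) := Subring {
  subring_set :> set F;
  subring_1 : subring_set 1;
  subring_B : forall a b, subring_set a -> subring_set b -> subring_set (a - b);
  subring_M : forall a b, subring_set a -> subring_set b -> subring_set (a * b) }.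

Section SubringType.
Variables (F : fieldType) (S : subring F).

Definition subring_pred : F -> bool := fun a => a \in (S : set F).

Lemma subring_pred_closed : subring_closed subring_pred.
Proof.
split; first exact/mem_set/subring_1.
- by move=> a b /set_mem ha /set_mem hb; apply/mem_set/subring_B.
- by move=> a b /set_mem ha /set_mem hb; apply/mem_set/subring_M.
Qed.

HB.instance Definition _ :=
  GRing.isSubringClosed.Build F subring_pred subring_pred_closed.

Definition ring_of := {a : F | subring_pred a}.
HB.instance Definition _ := SubChoice.on ring_of.
HB.instance Definition _ := [SubChoice_isSubComNzRing of ring_of by <:].

Lemma ring_ofP (a : ring_of) : (S : set F) (val a).
Proof. exact/set_mem/(valP a). Qed.

Definition to_ring (a : F) (h : (S : set F) a) : ring_of :=
  exist subring_pred a (mem_set h).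

End SubringType.

Section IntegralClosure.
Variables (F K : fieldType) (iota : {rmorphism F -> K}) (S : subring F).

Definition structure_map : ring_of S -> K := iota \o val.
HB.instance Definition _ := GRing.RMorphism.on structure_map.

Lemma structure_mapE a : structure_map a = iota (val a). Proof. by []. Qed.

Definition integral_closure : subring K.
Proof.
refine (@Subring K [set a | integralOver structure_map a] _ _ _).
- exact: integral1.
- by move=> a b; exact: integral_sub.
- by move=> a b; exact: integral_mul.
Defined.

Definition to_closure (a : ring_of S) : ring_of integral_closure :=
  to_ring (S := integral_closure) (integral_id structure_map a).

Lemma to_closure_zmod : zmod_morphism to_closure.
Proof. by move=> a b; apply: val_inj; rewrite /= !raddfB. Qed.
Lemma to_closure_monoid : monoid_morphism to_closure.
Proof.
by split=> [|a b]; apply: val_inj; rewrite /= ?rmorph1 ?rmorphM.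
Qed.
HB.instance Definition _ := GRing.isZmodMorphism.Build _ _ to_closure to_closure_zmod.
HB.instance Definition _ := GRing.isMonoidMorphism.Build _ _ to_closure to_closure_monoid.

End IntegralClosure.

Section FunctionField.
Variables (X : ringed_space) (K0 : fieldType) (ff : function_field X K0).

Definition sections (U : opens X) (hU : U !=set0) : subring K0.
Proof.
refine (@Subring K0 (range (germ ff hU)) _ _ _).
- by exists 1 => //; rewrite rmorph1.
- by move=> _ _ [a _ <-] [b _ <-]; exists (a - b); rewrite ?rmorphB.
- by move=> _ _ [a _ <-] [b _ <-]; exists (a * b); rewrite ?rmorphM.
Defined.

Lemma germ_common (U V : opens X) (hU : U !=set0) (hV : V !=set0) x (s : sect U) (t : sect V) :
  opens_set U x -> opens_set V x ->
  exists (W : opens X) (hW : W !=set0) s' t',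
    [/\ opens_set W x, germ ff hU s = germ ff hW s' & germ ff hV t = germ ff hW t'].
Proof.
move=> Ux Vx.
have hW : opensI U V !=set0 by exists x.
have WU : opensI U V `<=` U by move=> ? [].
have WV : opensI U V `<=` V by move=> ? [].
by exists (opensI U V), hW, (res WU s), (res WV t); split; rewrite ?germ_res.
Qed.

(* O_{X,x} as a subring of K0; for integral X the germs at x embed into K0. *)
Definition stalk (x : X) : subring K0.
Proof.
refine (@Subring K0 [set a | exists (U : opens X) (hU : U !=set0),
  opens_set U x /\ exists s, germ ff hU s = a] _ _ _).
- pose U := Opens (@openT X).
  have hU : U !=set0 by exists x.
  by exists U, hU; split=> //; exists 1; rewrite rmorph1.
- move=> a b [U [hU [Ux [s <-]]]] [V [hV [Vx [t <-]]]].
  have [W [hW [s' [t' [Wx -> ->]]]]] := germ_common hU hV s t Ux Vx.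
  by exists W, hW; split=> //; exists (s' - t'); rewrite rmorphB.
- move=> a b [U [hU [Ux [s <-]]]] [V [hV [Vx [t <-]]]].
  have [W [hW [s' [t' [Wx -> ->]]]]] := germ_common hU hV s t Ux Vx.
  by exists W, hW; split=> //; exists (s' * t'); rewrite rmorphM.
Defined.

Definition max_ideal (x : X) : set (ring_of (stalk x)) :=
  [set a | ~ exists b, a * b = 1].

(* the positive residue characteristics of X *)
Definition residue_chars : set nat :=
  [set p | prime p /\ exists x : X, max_ideal (p%:R : ring_of (stalk x))].

(* K0 is the fraction field of each O_{X,x} *)
Definition is_normal : Prop :=
  forall (x : X) (a : K0),
    integralOver (fun b : ring_of (stalk x) => val b) a -> (stalk x : set K0) a.

End FunctionField.

Section PreimageIdeal.
Variables (A B : comNzRingType) (f : {rmorphism A -> B}) (I : prime_idealr B).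

Definition preim_ideal : A -> bool := fun a => f a \in (I : pred B).

Lemma preim_idealr_closed : idealr_closed preim_ideal.
Proof.
split=> [||a u v]; rewrite -!topredE /=.
- by rewrite /preim_ideal rmorph0 idealr0.
- by rewrite /preim_ideal rmorph1 idealr1.
- by rewrite /preim_ideal rmorphD rmorphM => hu hv; rewrite rpredD // idealMr.
Qed.
HB.instance Definition _ := isIdealr.Build A preim_ideal preim_idealr_closed.

Lemma preim_prime_closed : prime_idealr_closed preim_ideal.
Proof. by move=> u v; rewrite /in_mem /= /preim_ideal rmorphM prime_idealrM. Qed.
HB.instance Definition _ :=
  isPrimeIdealrClosed.Build A preim_ideal preim_prime_closed.

End PreimageIdeal.

Lemma prime_idealr_ext (A : comNzRingType) (I J : prime_idealr A) :
  (I : A -> bool) =1 J -> I = J.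
Proof.
case: I => I [[a] [b] [c] [d]]; case: J => J [[a'] [b'] [c'] [d']] /= /funext E.
case: J / E a' b' c' d' => a' b' c' d'.
by congr (PrimeIdealr.Pack (PrimeIdealr.Class _ _ _ _)); congr (_ _); exact: Prop_irrelevance.
Qed.

Section Normalization.
Variables (X0 : ringed_space) (K0 : fieldType) (ff : function_field X0 K0).
Variables (K : fieldType) (iota : {rmorphism K0 -> K}).

(* The fibre over x0 consists of the primes of the integral closure of
   O_{X0,x0} in K lying over the maximal ideal. *)
Record point := Point {
  base : X0;
  pt_ideal : prime_idealr (ring_of (integral_closure iota (stalk ff base)));
  pt_over : forall a, max_ideal a <-> to_closure iota a \in (pt_ideal : pred _) }.

Definition pt_ring (x : point) := ring_of (integral_closure iota (stalk ff (base x))).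

(* These primes are maximal, so the quotient is the residue field. *)
Definition kappa (x : point) := {ideal_quot (pt_ideal x)}.

HB.instance Definition _ x := GRing.ComNzRing.on (kappa x).

Definition residue (x : point) : pt_ring x -> kappa x := \pi_(kappa x).
HB.instance Definition _ x := GRing.RMorphism.copy (@residue x) (\pi_(kappa x)).

Lemma residue_eq0 x (a : pt_ring x) :
  (residue a == 0) = (a \in (pt_ideal x : pred _)).
Proof.
rewrite -(rmorph0 (@residue x)) /residue eqmodE /=.
by rewrite /Quotient.equiv subr0.
Qed.

Lemma residue_surj x (y : kappa x) : exists a, residue a = y.
Proof. by exists (repr y); rewrite /residue reprK. Qed.

Lemma kappa_idomain x (y z : kappa x) : y * z = 0 -> (y == 0) || (z == 0).
Proof. exact: Quotient.rquot_IdomainAxiom. Qed.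

Lemma integral_inv_aux (D : comNzRingType)
    (hD : forall y z : D, y * z = 0 -> (y == 0) || (z == 0)) (y : D) (p : {poly D}) :
  y != 0 -> p \is monic ->
  (forall i, p`_i = 0 \/ exists b, b * p`_i = 1) ->
  p.[y] = 0 -> exists b, b * y = 1.
Proof.
move=> y0; elim/poly_ind: p => [|p c IH] mon hc py.
  by move: mon; rewrite monicE lead_coef0 eq_sym oner_eq0.
have [p0|p0] := eqVneq p 0.
  move: mon py; rewrite p0 mul0r add0r hornerC monicE lead_coefC => /eqP -> /eqP.
  by rewrite oner_eq0.
have hcc : (p * 'X + c%:P)`_0 = c by rewrite coefD coefMX coefC add0r.
have hcS i : (p * 'X + c%:P)`_i.+1 = p`_i by rewrite coefD coefMX coefC addr0.
have monp : p \is monic.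
  move: mon; rewrite !monicE lead_coefDl ?lead_coefMX //.
  by rewrite size_mulX // size_polyC ltnS (leq_trans (leq_b1 _)) // lt0n size_poly_eq0.
move: py; rewrite hornerD hornerMX hornerC => py.
have := hc 0%N; rewrite hcc => -[hc0|[b bc]].
  move: py; rewrite hc0 addr0 => /hD /orP[/eqP py|]; last by rewrite (negPf y0).
  by apply: IH => // i; rewrite -hcS.
exists (- (b * p.[y])); rewrite mulNr -mulrA.
by move/eqP: py; rewrite addr_eq0 => /eqP ->; rewrite mulrN opprK.
Qed.

Lemma kappa_unit x (y : kappa x) : y != 0 -> exists b, b * y = 1.
Proof.
have [a <-] := residue_surj y; case: (ring_ofP a) => p mon /rootP pa0 y0.
pose q := map_poly (@residue x \o to_closure iota (S := stalk ff (base x))) p.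
have := @integral_inv_aux _ (@kappa_idomain x) (residue a) q y0.
apply.
- exact: monic_map.
- move=> i; rewrite coef_map /=; have [m|] := pselect (max_ideal p`_i).
    by left; apply/eqP; rewrite residue_eq0; exact/pt_over.
  move=> /contrapT[b ab]; right; exists (residue (to_closure iota b)).
  by rewrite -!rmorphM mulrC ab !rmorph1.
- rewrite /q map_poly_comp horner_map (_ : _.[a] = 0) ?rmorph0 //; apply: val_inj.
  rewrite [RHS]rmorph0 -pa0 -[LHS]horner_map -map_poly_comp.
  by congr (_.[_]); apply: eq_map_poly.
Qed.

Definition kappa_inv x (y : kappa x) : kappa x := xget 0 [set b | b * y = 1].

Lemma kappa_mulVf x (y : kappa x) : y != 0 -> kappa_inv y * y = 1.
Proof. by move=> /kappa_unit[b hb]; rewrite /kappa_inv; case: xgetP => // /(_ b). Qed.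

Lemma kappa_inv0 x : kappa_inv (0 : kappa x) = 0.
Proof.
rewrite /kappa_inv; case: xgetP => // b _ /=; rewrite mulr0 => /eqP.
by rewrite eq_sym oner_eq0.
Qed.

HB.instance Definition _ x :=
  GRing.ComNzRing_isField.Build (kappa x) (@kappa_mulVf x) (@kappa_inv0 x).

End Normalization.

Record galois_aut (K0 K : fieldType) (iota : {rmorphism K0 -> K}) := GaloisAut {
  gal_fun :> {rmorphism K -> K};
  gal_bij : bijective gal_fun;
  gal_fix : forall a, gal_fun (iota a) = iota a }.

Section GaloisGroup.
Variables (K0 K : fieldType) (iota : {rmorphism K0 -> K}).

Definition gal_id : galois_aut iota.
Proof. by refine (@GaloisAut _ _ iota idfun _ _) => //; exists id. Defined.

Definition gal_comp (g h : galois_aut iota) : galois_aut iota.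
Proof.
refine (@GaloisAut _ _ iota (g \o h) _ _).
- exact: bij_comp (gal_bij g) (gal_bij h).
- by move=> a /=; rewrite !gal_fix.
Defined.

Lemma gal_inv_ex (g : galois_aut iota) :
  exists h : galois_aut iota, cancel g h /\ cancel h g.
Proof.
have [f fK Kf] := gal_bij g.
have fz : zmod_morphism f by move=> a b; apply: (can_inj fK); rewrite rmorphB !Kf.
have fm : monoid_morphism f.
  by split=> [|a b]; apply: (can_inj fK); rewrite ?rmorphM ?rmorph1 !Kf.
pose fz' := GRing.isZmodMorphism.Build _ _ f fz.
pose fm' := GRing.isMonoidMorphism.Build _ _ f fm.
pose F : {rmorphism K -> K} := HB.pack f fz' fm'.
have Fb : bijective F by exists g.
have Ff a : F (iota a) = iota a by apply: (can_inj fK); rewrite Kf gal_fix.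
by exists (GaloisAut Fb Ff).
Qed.

Variables (S : subring K0) (g : galois_aut iota).
Let A := integral_closure iota S.

Lemma gal_integral (a : K) : (A : set K) a -> (A : set K) (g a).
Proof.
move=> /(@integral_rmorph _ _ _ (structure_map iota (S := S)) g).
rewrite (_ : g \o structure_map iota (S := S) = structure_map iota (S := S)) //.
by apply/funext => b /=; exact: gal_fix.
Qed.

Definition gal_closure (a : ring_of A) : ring_of A :=
  to_ring (gal_integral (ring_ofP a)).

Lemma gal_closure_zmod : zmod_morphism gal_closure.
Proof. by move=> a b; apply: val_inj; rewrite /= !raddfB. Qed.
Lemma gal_closure_monoid : monoid_morphism gal_closure.
Proof. by split=> [|a b]; apply: val_inj; rewrite /= ?rmorph1 ?rmorphM. Qed.
HB.instance Definition _ := GRing.isZmodMorphism.Build _ _ gal_closure gal_closure_zmod.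
HB.instance Definition _ := GRing.isMonoidMorphism.Build _ _ gal_closure gal_closure_monoid.

End GaloisGroup.

Section GaloisPoint.
Variables (X0 : ringed_space) (K0 : fieldType) (ff : function_field X0 K0).
Variables (K : fieldType) (iota : {rmorphism K0 -> K}).
Variables (x : point ff iota) (g : galois_aut iota).

(* x^g is given by the preimage g^-1(q) of the prime q of x. *)
Definition gal_point : point ff iota.
Proof.
refine (@Point _ _ ff _ iota (base x) (preim_ideal (gal_closure g) (pt_ideal x)) _).
move=> a; have E : gal_closure g (to_closure iota a) = to_closure iota a.
  by apply: val_inj; exact: gal_fix.
by rewrite pt_over -{1}E.
Defined.

(* the induced isomorphism kappa(x^g) -> kappa(x) *)
Definition gal_kappa (y : kappa gal_point) : kappa x :=
  residue (gal_closure g (repr y) : pt_ring x).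

Lemma gal_kappaE (a : pt_ring gal_point) :
  gal_kappa (residue a) = residue (gal_closure g a : pt_ring x).
Proof.
apply/eqP; rewrite -subr_eq0 -rmorphB residue_eq0 -raddfB.
have : residue (repr (residue a) - a : pt_ring gal_point) == 0.
  by rewrite rmorphB subr_eq0; apply/eqP; exact: reprK.
by rewrite residue_eq0 -topredE.
Qed.

End GaloisPoint.

Section Characters.
Variables (X0 : ringed_space) (K0 : fieldType) (ff : function_field X0 K0).
Variables (K : fieldType) (iota : {rmorphism K0 -> K}) (C : fieldType).

(* The group homomorphism kappa(x)^* -> C^* is extended by 0 |-> 0. *)
Record char_point := CharPoint {
  pt : point ff iota;
  chi : kappa pt -> C;
  chi0 : chi 0 = 0;
  chi1 : chi 1 = 1;
  chiM : forall a b, chi (a * b) = chi a * chi b }.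

Lemma chi_eq0 (P : char_point) (a : kappa (pt P)) : (chi a == 0) = (a == 0).
Proof.
apply/eqP/eqP => [h|->]; last exact: chi0.
apply/eqP; apply: contraPT h => a0 h.
by have := chi1 P; rewrite -(mulVf a0) chiM h mulr0 => /eqP; rewrite eq_sym oner_eq0.
Qed.

Lemma chiX (P : char_point) (a : kappa (pt P)) n : chi (a ^+ n) = chi a ^+ n.
Proof. by elim: n => [|n IH]; rewrite ?chi1 // !exprS chiM IH. Qed.

(* The multiplicative map P(r) = chi(r mod q) for r in the integral closure of
   O_{X0,x0}, so in particular for r in the normalization of O(U), x0 in U. *)
Definition ev (P : char_point) (r : K) : C :=
  if insub r is Some a then chi (residue (a : pt_ring (pt P))) else 0.

Lemma evE (P : char_point) (a : pt_ring (pt P)) : ev P (val a) = chi (residue a).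
Proof. by rewrite /ev valK. Qed.

Lemma char_point_ext (P P' : char_point) :
  base (pt P) = base (pt P') -> ev P =1 ev P' -> P = P'.
Proof.
case: P => -[x I hI] c c0 c1 cM; case: P' => -[x' I' hI'] c' c0' c1' cM' /= Ex Eev.
case: x' / Ex I' hI' c' c0' c1' cM' Eev => I' hI' c' c0' c1' cM' Eev.
have EI : I = I'.
  apply: prime_idealr_ext => a.
  have := @evE (CharPoint c0 c1 cM) a.
  rewrite Eev (@evE (CharPoint c0' c1' cM') a) => /= E.
  have := congr1 (fun z => z == 0) E.
  rewrite (@chi_eq0 (CharPoint c0 c1 cM)) (@chi_eq0 (CharPoint c0' c1' cM')).
  by rewrite !residue_eq0 -!topredE.
case: I' / EI hI' c' c0' c1' cM' Eev => hI'.
rewrite (Prop_irrelevance hI' hI) => c' c0' c1' cM' Eev.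
have Ec : c = c'.
  apply/funext => y; have [a <-] := residue_surj y.
  have := @evE (CharPoint c0 c1 cM) a.
  by rewrite Eev (@evE (CharPoint c0' c1' cM') a) /= => ->.
case: c' / Ec c0' c1' cM' Eev => c0' c1' cM' _.
by congr CharPoint; exact: Prop_irrelevance.
Qed.

Section Frob.
Variables (n : nat) (P : char_point).

Definition frob_chi (a : kappa (pt P)) : C := if a == 0 then 0 else chi (a ^+ n).

Fact frob_chi0 : frob_chi 0 = 0. Proof. by rewrite /frob_chi eqxx. Qed.
Fact frob_chi1 : frob_chi 1 = 1.
Proof. by rewrite /frob_chi oner_eq0 expr1n chi1. Qed.
Fact frob_chiM a b : frob_chi (a * b) = frob_chi a * frob_chi b.
Proof.
rewrite /frob_chi mulf_eq0; have [|a0] /= := eqVneq a 0; first by rewrite mul0r.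
by have [|b0] /= := eqVneq b 0; rewrite ?mulr0 // exprMn chiM.
Qed.

Definition frob : char_point := CharPoint frob_chi0 frob_chi1 frob_chiM.
End Frob.

Section GaloisAction.
Variables (g : galois_aut iota) (P : char_point).

Definition gal_chi (a : kappa (gal_point (pt P) g)) : C := chi (gal_kappa a).

Fact gal_chi0 : gal_chi 0 = 0.
Proof.
by rewrite -(rmorph0 (@residue _ _ _ _ _ _)) /gal_chi gal_kappaE !raddf0 chi0.
Qed.
Fact gal_chi1 : gal_chi 1 = 1.
Proof.
by rewrite -(rmorph1 (@residue _ _ _ _ _ _)) /gal_chi gal_kappaE !rmorph1 chi1.
Qed.
Fact gal_chiM a b : gal_chi (a * b) = gal_chi a * gal_chi b.
Proof.
have [a' <-] := residue_surj a; have [b' <-] := residue_surj b.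
by rewrite -rmorphM /gal_chi !gal_kappaE -chiM -!rmorphM.
Qed.

Definition gal_char : char_point := CharPoint gal_chi0 gal_chi1 gal_chiM.
End GaloisAction.
End Characters.

Section RootsOfUnity.

Lemma card_eq_uniq_seq (T : choiceType) (A : set T) n : (A #= `I_n)%card <->
  exists rs : seq T, [/\ uniq rs, A = [set` rs] & size rs = n].
Proof.
have fwd (B : set T) m : (B #= `I_m)%card ->
    exists rs : seq T, [/\ uniq rs, B = [set` rs] & size rs = m].
  move=> Bm; have fB : finite_set B by apply/finite_setP; exists m.
  exists (enum_fset (fset_set B)); split; first exact: fset_uniq.
    by apply/seteqP; split=> x /=; rewrite in_fset_set // inE.
  exact: card_fset_set.
split=> [|[rs [Urs -> <-]]]; first exact: fwd.
have /finite_setP[m hm] := finite_seq rs.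
suff <- : m = size rs by [].
have [rs' [Urs' E <-]] := fwd _ _ hm; apply/esym/perm_size/uniq_perm => // x.
by have /= h := congr1 (fun S : set T => S x) E; apply/idP/idP; rewrite h.
Qed.

Variable k : fieldType.

Lemma uniq_mul_closed_order (rs : seq k) a : uniq rs -> a \in rs ->
  {in rs &, forall x y, x * y \in rs} -> {in rs, forall x, x != 0} ->
  a ^+ size rs = 1.
Proof.
move=> Urs ars rsM rs0.
have p : perm_eq [seq a * x | x <- rs] rs.
  have U : uniq [seq a * x | x <- rs] by rewrite map_inj_uniq //; exact/mulfI/rs0.
  have sub : {subset [seq a * x | x <- rs] <= rs}.
    by move=> _ /mapP[x xrs ->]; exact: rsM.
  by have [|_ E] := uniq_min_size U sub; rewrite ?size_map // uniq_perm.
have : \prod_(x <- rs) (a * x) = \prod_(x <- rs) x.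
  by rewrite -(big_map (fun x => a * x) xpredT id); exact: perm_big.
rewrite big_split /= big_const_seq count_predT iter_mulr_1 => E.
have h0 : \prod_(x <- rs) x != 0.
  by rewrite prodf_seq_neq0; apply/allP => x /rs0.
by apply: (mulIf h0); rewrite mul1r.
Qed.

Lemma unity_root_seq n : (0 < n)%N -> exists rs : seq k,
  [/\ uniq rs, forall a, (a \in rs) = (a ^+ n == 1) & (size rs %| n)%N].
Proof.
move=> n0.
pose Q d := `[< exists rs : seq k, [/\ uniq rs, all n.-unity_root rs & size rs = d] >].
have exQ : exists d, Q d by exists 0%N; apply/asboolP; exists [::].
have bQ d : Q d -> (d <= n)%N by move=> /asboolP[rs [U h <-]]; exact: max_unity_roots.
case: (ex_maxnP exQ bQ) => d /asboolP[rs [U h sz]] dmax.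
have rsE a : (a \in rs) = (a ^+ n == 1).
  apply/idP/idP => [/(allP h)|an]; first by rewrite unity_rootE.
  apply: contraT => nars; suff : (d.+1 <= d)%N by rewrite ltnn.
  apply: dmax; apply/asboolP; exists (a :: rs); split; rewrite /= ?nars ?sz //.
  by rewrite h unity_rootE an.
have rs_neq0 : {in rs, forall x, x != 0}.
  move=> x; rewrite rsE; apply: contraTneq => ->.
  by rewrite expr0n gtn_eqF // eq_sym oner_eq0.
have d0 : (0 < size rs)%N.
  have : 1 \in rs by rewrite rsE expr1n.
  by case: (rs).
have /hasP[z zrs zprim] : has (size rs).-primitive_root rs.
  apply: has_prim_root => //; apply/allP => x xrs; rewrite unity_rootE.
  rewrite (@uniq_mul_closed_order rs) // => u v.
  by rewrite !rsE exprMn => /eqP -> /eqP ->; rewrite mulr1.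
exists rs; split=> //.
by rewrite (prim_order_dvd zprim) -rsE.
Qed.

End RootsOfUnity.

Section CharacterTheory.
Variables (X0 : ringed_space) (K0 : fieldType) (ff : function_field X0 K0).
Variables (K : closedFieldType) (iota : {rmorphism K0 -> K}) (C : fieldType).
Local Notation char_point := (char_point ff iota C).

Lemma ev_frob n (P : char_point) a : (0 < n)%N -> ev (frob n P) a = ev P a ^+ n.
Proof.
move=> n0; rewrite /ev; case: insubP => [u _ _|_]; last by rewrite expr0n gtn_eqF.
rewrite /= /frob_chi; case: eqVneq => [->|_]; first by rewrite chi0 expr0n gtn_eqF.
by rewrite chiX.
Qed.

Lemma ev_gal g (P : char_point) a : ev (gal_char g P) a = ev P (g a).
Proof.
rewrite [LHS]/ev; case: insubP => [u hu <-|hn].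
  by rewrite /= /gal_chi gal_kappaE -evE.
rewrite /ev insubF //; apply/negbTE; apply: contra hn => /set_mem h.
have [h' [gK _]] := gal_inv_ex g.
by apply/mem_set; rewrite -(gK a); exact: gal_integral.
Qed.

Lemma frob1 (P : char_point) : frob 1 P = P.
Proof. by apply: char_point_ext => // a; rewrite ev_frob ?expr1. Qed.

Lemma frobM m n (P : char_point) : (0 < m)%N -> (0 < n)%N ->
  frob (m * n) P = frob m (frob n P).
Proof.
move=> m0 n0; apply: char_point_ext => // a.
by rewrite !ev_frob ?muln_gt0 ?m0 // mulnC exprM.
Qed.

Lemma gal_frob g n (P : char_point) : (0 < n)%N ->
  gal_char g (frob n P) = frob n (gal_char g P).
Proof. by move=> n0; apply: char_point_ext => // a; rewrite !(ev_gal, ev_frob). Qed.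

Lemma gal_char_id (P : char_point) : gal_char (gal_id iota) P = P.
Proof. by apply: char_point_ext => // a; rewrite ev_gal. Qed.

Lemma gal_char_comp g h (P : char_point) :
  gal_char h (gal_char g P) = gal_char (gal_comp g h) P.
Proof. by apply: char_point_ext => // a; rewrite !ev_gal. Qed.

Lemma gal_char_inv (g : galois_aut iota) : exists h : galois_aut iota,
  forall P : char_point, gal_char h (gal_char g P) = P.
Proof.
have [h [_ hK]] := gal_inv_ex g; exists h => P.
by apply: char_point_ext => // a; rewrite !ev_gal hK.
Qed.

Lemma kappa_root (x : point ff iota) (y : kappa x) n : (0 < n)%N ->
  exists z, z ^+ n = y.
Proof.
move=> n0; have [a <-] := residue_surj y.
have : size ('X^n - (val a)%:P : {poly K}) != 1%N by rewrite size_XnsubC // eqSS -lt0n.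
move=> /closed_rootP[b /rootP]; rewrite !hornerE => /eqP; rewrite subr_eq0 => /eqP ba.
have hb : (integral_closure iota (stalk ff (base x)) : set K) b.
  apply: (@integral_root_monic _ _ (structure_map iota (S := stalk ff (base x)))
    b ('X^n - (val a)%:P)); first exact: monicXnsubC.
    by apply/rootP; rewrite !hornerE ba subrr.
  apply/integral_poly => i; rewrite coefB coefXn coefC; apply: integral_sub.
    exact: integral_nat.
  by case: ifP => _; [exact: (ring_ofP a)|exact: integral0].
exists (residue (to_ring hb : pt_ring x)); rewrite -rmorphXn; congr residue.
by apply: val_inj; rewrite rmorphXn.
Qed.

Lemma frob_inj n : (0 < n)%N -> injective (@frob _ _ ff _ iota C n).
Proof.
move=> n0 [x c c0 c1 cM] [x' c' c0' c1' cM'] E.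
have Ex : x = x' by have := congr1 (@pt _ _ _ _ _ _) E.
case: x' / Ex c' c0' c1' cM' E => c' c0' c1' cM' E.
apply: char_point_ext => // a; rewrite /ev; case: insubP => //= u _ _.
have [z <-] := kappa_root (residue (u : pt_ring x)) n0.
have [b <-] := residue_surj z.
have /= -> := @chiX _ _ _ _ _ _ (CharPoint c0 c1 cM) (residue b) n.
have /= -> := @chiX _ _ _ _ _ _ (CharPoint c0' c1' cM') (residue b) n.
have /= <- := @evE _ _ _ _ _ _ (CharPoint c0 c1 cM) b.
have /= <- := @evE _ _ _ _ _ _ (CharPoint c0' c1' cM') b.
by rewrite -!ev_frob // E.
Qed.

Lemma frob_divide n (P : char_point) : (0 < n)%N ->
  (forall z : kappa (pt P), z ^+ n = 1 -> chi z = 1) ->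
  exists2 P', pt P' = pt P & frob n P' = P.
Proof.
move=> n0 hker; pose rt (y : kappa (pt P)) := xget 0 [set z | z ^+ n = y].
have rtK y : rt y ^+ n = y.
  have [z hz] := kappa_root y n0; rewrite /rt; case: xgetP => // /(_ z); contradiction.
have inj (y z : kappa (pt P)) : y ^+ n = z ^+ n -> chi y = chi z.
  have [->|z0] := eqVneq z 0.
    by rewrite expr0n gtn_eqF // => /eqP; rewrite expf_eq0 n0 /= => /eqP ->.
  move=> E; have h : (y / z) ^+ n = 1 by rewrite expr_div_n E divff ?expf_neq0.
  by rewrite -[y](divfK z0) chiM (hker _ h) mul1r.
have r0 : chi (rt 0) = 0 by rewrite -(chi0 P); apply: inj; rewrite rtK expr0n gtn_eqF.
have r1 : chi (rt 1) = 1 by rewrite -(chi1 P); apply: inj; rewrite rtK expr1n.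
have rM a b : chi (rt (a * b)) = chi (rt a) * chi (rt b).
  by rewrite -chiM; apply: inj; rewrite exprMn !rtK.
exists (CharPoint r0 r1 rM) => //; apply: char_point_ext => // a.
rewrite /ev; case: insubP => //= u _ _; rewrite /frob_chi; case: eqVneq => [->|_]; first by rewrite chi0.
by apply: inj; rewrite rtK.
Qed.

Definition root_of_unity (k : fieldType) : set k :=
  [set a | exists2 n, (0 < n)%N & a ^+ n = 1].

Definition inj_set : set char_point :=
  [set P | {in @root_of_unity (kappa (pt P)) &, injective (@chi _ _ _ _ _ _ P)}].

Definition inj_set_char (p : nat) : set char_point :=
  [set P | inj_set P /\ p \in [pchar (kappa (pt P))]].

Definition inj_set_char0 : set char_point :=
  [set P | inj_set P /\ [pchar (kappa (pt P))] =i pred0].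

Definition ker_tors (P : char_point) : set (kappa (pt P)) :=
  [set a | root_of_unity a /\ chi a = 1].

Definition tors_set (N : nat_pred) : set char_point :=
  [set P | exists2 n, N.-nat n & (@ker_tors P #= `I_n)%card].

Lemma inj_set_tors N : inj_set `<=` tors_set N.
Proof.
move=> P hP; exists 1%N => //.
suff -> : @ker_tors P = [set 1] by exact: card_set1.
have mu1 : (1 : kappa (pt P)) \in @root_of_unity (kappa (pt P)).
  by apply/mem_set; exists 1%N => //; rewrite expr1.
apply/seteqP; split=> [a [ha Pa]|_ ->].
  by apply: hP; rewrite ?Pa ?chi1 //; exact/mem_set.
by split; [exact/set_mem|exact: chi1].
Qed.

Lemma tors_set_frob N n : N.-nat n -> tors_set N `<=` frob n @^-1` tors_set N.
Proof.
move=> hn P [m hm /card_eq_uniq_seq[rs [Urs TE szrs]]].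
have m0 : (0 < m)%N by case/andP: hm.
have n0 : (0 < n)%N by case/andP: hn.
have rsP a : a \in rs <-> @ker_tors P a by rewrite TE.
have [rs' [Urs' rs'E sz']] := unity_root_seq (kappa (pt P)) (m0).
have rsE a : (a \in rs) = (a ^+ m == 1).
  have sub : {subset rs <= rs'}.
    move=> b brs; rewrite rs'E -szrs (@uniq_mul_closed_order _ rs) //.
      move=> x y /rsP[[i i0 xi] Px] /rsP[[j j0 yj] Py]; apply/rsP; split.
        exists (i * j)%N; first by rewrite muln_gt0 i0.
        by rewrite exprMn exprM xi expr1n mulnC exprM yj expr1n mul1r.
      by rewrite chiM Px Py mulr1.
    by move=> x /rsP[_ Px]; rewrite -chi_eq0 Px oner_eq0.
  rewrite -rs'E; have [//|_ ->//] := uniq_min_size Urs sub.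
  by rewrite szrs dvdn_leq.
have mn0 : (0 < m * n)%N by rewrite muln_gt0 m0.
have [ts [Uts tsE tsz]] := unity_root_seq (kappa (pt P)) mn0.
exists (size ts); first by rewrite (pnat_dvd tsz) // pnatM hm.
apply/card_eq_uniq_seq; exists ts; split=> //; apply/seteqP; split=> a /=.
  move=> [[i i0 ai]] /=; rewrite /frob_chi; case: eqVneq => [_|a0 Pa].
    by move/eqP; rewrite eq_sym oner_eq0.
  rewrite tsE mulnC exprM -rsE; apply/rsP; split=> //.
  by exists i => //; rewrite exprAC ai expr1n.
rewrite tsE => /eqP amn; split; first by exists (m * n)%N.
rewrite /= /frob_chi; case: eqVneq => [a0|_].
  by move/eqP: amn; rewrite a0 expr0n gtn_eqF // eq_sym oner_eq0.
have /rsP[] // : a ^+ n \in rs by rewrite rsE -exprM mulnC amn.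
Qed.

End CharacterTheory.

Arguments inj_set {X0 K0} ff {K} iota C _.
Arguments inj_set_char {X0 K0} ff {K} iota C p _.
Arguments inj_set_char0 {X0 K0} ff {K} iota C _.
Arguments tors_set {X0 K0} ff {K} iota C N _.

Record equivalence (T : Type) := Equivalence {
  equiv_rel_of :> T -> T -> Prop;
  equiv_refl : forall x, equiv_rel_of x x;
  equiv_sym : forall x y, equiv_rel_of x y -> equiv_rel_of y x;
  equiv_trans : forall x y z,
    equiv_rel_of x y -> equiv_rel_of y z -> equiv_rel_of x z }.

Section QuotientSpace.
Variables (T : topologicalType) (E : equivalence T).

Definition equivb (x y : T) : bool := `[< E x y >].

Lemma equivb_class : equiv_class_of equivb.
Proof.
split=> [x|x y|y x z]; first exact/asboolP/equiv_refl.
  by apply/idP/idP => /asboolP h; exact/asboolP/(equiv_sym h).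
by move=> /asboolP xy /asboolP yz; apply/asboolP/(equiv_trans xy yz).
Qed.

Canonical equivb_equiv := EquivRelPack equivb_class.
Canonical equivb_encModRel := defaultEncModRel equivb.

Definition quot : Type := quotient_topology {eq_quot equivb}.
HB.instance Definition _ := Topological.on quot.

Definition cls (x : T) : quot := \pi_{eq_quot equivb} x.
Definition cls_repr (z : quot) : T := repr (z : {eq_quot equivb}).

Lemma cls_reprK z : cls (cls_repr z) = z.
Proof. exact: reprK. Qed.

Lemma cls_eqP x y : cls x = cls y <-> E x y.
Proof.
have -> : (cls x = cls y) = (x = y %[mod {eq_quot equivb}]) by [].
by split=> [/eqmodP/asboolP|h]; last exact/eqmodP/asboolP.
Qed.

Lemma cls_reprE x : E (cls_repr (cls x)) x.
Proof. by apply/cls_eqP; rewrite cls_reprK. Qed.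

Lemma open_quotE (Z : set quot) : open Z = open (cls @^-1` Z).
Proof. by []. Qed.

End QuotientSpace.

Section Exponents.
Variable N : nat_pred.

(* For a set N of primes: the submonoid of the positive integers generated by
   N.  For N = p prime these are the powers of p. *)
Definition exponent := {n : nat | N.-nat n}.

Lemma exponent_gt0 (n : exponent) : (0 < val n)%N.
Proof. by case: n => n /= /andP[]. Qed.

Fact one_exponent_proof : N.-nat 1. Proof. by []. Qed.
Definition one_exponent : exponent := exist _ 1%N one_exponent_proof.

Fact mul_exponent_proof (a b : exponent) : N.-nat (val a * val b).
Proof. by rewrite pnatM (valP a) (valP b). Qed.
Definition mul_exponent (a b : exponent) : exponent :=
  exist _ (val a * val b)%N (mul_exponent_proof a b).

Lemma mul_exponentC a b : mul_exponent a b = mul_exponent b a.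
Proof. by apply: val_inj; rewrite /= mulnC. Qed.

(* An action of the group Q of fractions of the monoid N, given by the
   bijections F_n, n in N; then F_{a/b} = F_b^-1 F_a. *)
Record fraction_action (M : Type) := FractionAction {
  fact :> exponent -> M -> M;
  fact1 : forall m, fact one_exponent m = m;
  factM : forall a b m, fact (mul_exponent a b) m = fact a (fact b m);
  fact_inj : forall a, injective (fact a);
  fact_surj : forall a m, exists m', fact a m' = m }.

End Exponents.

Section PositiveReals.
Variable R : realType.

Definition Rpos : Type := set_type [set u : R | 0 < u].
HB.instance Definition _ := Topological.on Rpos.

Fact Rpos_mul_proof (u v : Rpos) : val u * val v \in [set u : R | 0 < u].
Proof. by apply/mem_set; apply: mulr_gt0; [exact: (set_mem (valP u))|exact: (set_mem (valP v))]. Qed.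
Definition Rpos_mul (u v : Rpos) : Rpos := exist _ (val u * val v) (Rpos_mul_proof u v).

End PositiveReals.

Section TwistedProduct.
Variables (R : realType) (N : nat_pred) (M : topologicalType).
Variable F : fraction_action N M.

(* (m', u') = (F_q m, q^-1 u) with q = a/b *)
Definition twist_rel (x y : M * Rpos R) : Prop :=
  exists a b : exponent N, F a x.1 = F b y.1 /\
    (val a)%:R * val y.2 = (val b)%:R * val x.2 :> R.

Fact twist_refl x : twist_rel x x.
Proof. by exists (one_exponent N), (one_exponent N). Qed.
Fact twist_sym x y : twist_rel x y -> twist_rel y x.
Proof. by move=> [a [b [h k]]]; exists b, a. Qed.
Fact twist_trans x y z : twist_rel x y -> twist_rel y z -> twist_rel x z.
Proof.
move=> [a [b [h k]]] [c [d [h' k']]].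
exists (mul_exponent c a), (mul_exponent b d); split.
  by rewrite !factM h -factM mul_exponentC factM h'.
rewrite /= !natrM -mulrA mulrCA k'.
by rewrite mulrCA k mulrCA !mulrA [X in X * _]mulrC.
Qed.

Definition twisted_product : topologicalType :=
  quot (Equivalence twist_refl twist_sym twist_trans).

Definition tw (m : M) (u : Rpos R) : twisted_product := cls _ (m, u).

Definition tw_scale (z : twisted_product) (v : Rpos R) : twisted_product :=
  tw (cls_repr z).1 (Rpos_mul (cls_repr z).2 v).

Lemma tw_scaleE m u v : tw_scale (tw m u) v = tw m (Rpos_mul u v).
Proof.
apply/cls_eqP; rewrite /tw; have [a [b [h k]]] := cls_reprE (Equivalence twist_refl twist_sym twist_trans) (m, u).
by exists a, b; split=> //=; rewrite mulrA k mulrA.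
Qed.

End TwistedProduct.

Section QuotientAction.
Variables (N : nat_pred) (M : topologicalType) (F : fraction_action N M).
Variables (E : equivalence M).
Hypothesis FE : forall a x y, E (F a x) (F a y) <-> E x y.

Definition quot_fact (a : exponent N) (z : quot E) : quot E :=
  cls E (F a (cls_repr z)).

Lemma quot_factE a x : quot_fact a (cls E x) = cls E (F a x).
Proof. by apply/cls_eqP/FE/cls_reprE. Qed.

Fact quot_fact1 z : quot_fact (one_exponent N) z = z.
Proof. by rewrite -(cls_reprK z) quot_factE fact1. Qed.
Fact quot_factM a b z : quot_fact (mul_exponent a b) z = quot_fact a (quot_fact b z).
Proof. by rewrite -(cls_reprK z) !quot_factE factM. Qed.
Fact quot_fact_inj a : injective (quot_fact a).
Proof.
move=> z w; rewrite -(cls_reprK z) -(cls_reprK w) !quot_factE.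
by move=> /cls_eqP/FE/cls_eqP.
Qed.
Fact quot_fact_surj a z : exists z', quot_fact a z' = z.
Proof.
have [x hx] := fact_surj F a (cls_repr z).
by exists (cls E x); rewrite quot_factE hx cls_reprK.
Qed.

Definition quot_action : fraction_action N (quot E) :=
  FractionAction quot_fact1 quot_factM quot_fact_inj quot_fact_surj.

End QuotientAction.

Record closed_valued_field (R : realType) := ClosedValuedField {
  vf :> closedFieldType;
  absv : vf -> R;
  absv_ge0 : forall x, 0 <= absv x;
  absv_eq0 : forall x, absv x = 0 <-> x = 0;
  absvM : forall x y, absv (x * y) = absv x * absv y;
  absvD : forall x y, absv (x + y) <= absv x + absv y }.

Definition vtop (R : realType) (C : closed_valued_field R) : Type := C.

Section ValuedTopology.
Variables (R : realType) (C : closed_valued_field R).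
HB.instance Definition _ := Choice.copy (vtop C) C.

Definition vopen : set_system (vtop C) :=
  [set O | forall x : C, O x -> exists2 e : R, 0 < e &
     forall y : C, absv (y - x) < e -> O y].

Fact vopenT : vopen setT. Proof. by move=> x _; exists 1. Qed.
Fact vopenI : setI_closed vopen.
Proof.
move=> A B hA hB x [/hA[e e0 he] /hB[f f0 hf]]; exists (Num.min e f).
  by rewrite lt_min e0.
by move=> y; rewrite lt_min => /andP[/he ? /hf ?].
Qed.
Fact vopen_bigU (I : Type) (f : I -> set (vtop C)) :
  (forall i, vopen (f i)) -> vopen (\bigcup_i f i).
Proof.
move=> h x [i _ /h[e e0 he]]; exists e => // y /he; exact: bigcup_sup.
Qed.
HB.instance Definition _ :=
  isOpenTopological.Build (vtop C) vopenT vopenI vopen_bigU.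
End ValuedTopology.

Section Spaces.
Variables (X0 : ringed_space) (K0 : fieldType) (ff : function_field X0 K0).
Variables (K : closedFieldType) (iota : {rmorphism K0 -> K}).
Variables (R : realType) (C : closed_valued_field R).

Definition Xdot : Type := char_point ff iota C.
HB.instance Definition _ := gen_eqMixin Xdot.
HB.instance Definition _ := gen_choiceMixin Xdot.

(* For an affine open U, the ring of pi^-1(U) is the integral closure of O(U)
   in K, and Xdot_U carries the topology of pointwise convergence on it. *)
Definition Xdot_open : set_system Xdot :=
  [set O | forall (U : opens X0) (hU : U !=set0), affine_open U ->
     exists W : set {ptws ring_of (integral_closure iota (sections ff hU)) -> vtop C},
       open W /\ forall P : Xdot, opens_set U (base (pt P)) ->
         (O P <-> W (fun r => ev P (val r)))].

Fact Xdot_openT : Xdot_open setT.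
Proof. by move=> U hU _; exists setT; split=> //; exact: openT. Qed.
Fact Xdot_openI : setI_closed Xdot_open.
Proof.
move=> A B hA hB U hU aU.
have [W [oW hW]] := hA U hU aU; have [V [oV hV]] := hB U hU aU.
exists (W `&` V); split; first exact: openI.
by move=> P UP; split=> -[/(hW P UP) ? /(hV P UP) ?].
Qed.
Fact Xdot_open_bigU (I : Type) (f : I -> set Xdot) :
  (forall i, Xdot_open (f i)) -> Xdot_open (\bigcup_i f i).
Proof.
move=> h U hU aU; have /choice[W hW] := fun i => h i U hU aU.
exists (\bigcup_i W i); split; first by apply: bigcup_open => i _; case: (hW i).
by move=> P UP; split=> -[i _ /((hW i).2 P UP) ?]; exists i.
Qed.
HB.instance Definition _ :=
  isOpenTopological.Build Xdot Xdot_openT Xdot_openI Xdot_open_bigU.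

Section Orbits.
Variable S : set Xdot.

Definition orbit_rel (P Q : S) : Prop :=
  exists g : galois_aut iota, val Q = gal_char g (val P).

Fact orbit_refl P : orbit_rel P P.
Proof. by exists (gal_id iota); rewrite gal_char_id. Qed.
Fact orbit_sym P Q : orbit_rel P Q -> orbit_rel Q P.
Proof.
by move=> [g E]; have [h hK] := gal_char_inv ff C g; exists h; rewrite E hK.
Qed.
Fact orbit_trans P Q T : orbit_rel P Q -> orbit_rel Q T -> orbit_rel P T.
Proof. by move=> [g E] [h E']; exists (gal_comp g h); rewrite E' E gal_char_comp. Qed.

Definition orbit_equiv := Equivalence orbit_refl orbit_sym orbit_trans.
End Orbits.

(* the quotient of a G-stable subset S by G *)
Definition mod_gal (S : set Xdot) : topologicalType := quot (orbit_equiv S).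

Definition Xdot_in : set Xdot := inj_set ff iota C.
Definition Xdot_Qin : set Xdot := inj_set_char0 ff iota C.
Definition Xdot_pin (p : nat) : set Xdot := inj_set_char ff iota C p.

Section FrobeniusAction.
Variable p : nat.

Lemma pin_prime (P : Xdot) : Xdot_pin p P -> prime p.
Proof. by move=> [_ /andP[]]. Qed.

Lemma pin_expr_inj (P : Xdot) (a : exponent p) : Xdot_pin p P ->
  injective (fun x : kappa (pt P) => x ^+ val a).
Proof.
move=> [_ hp] x y /eqP; rewrite -subr_eq0.
have ha : [pchar (kappa (pt P))].-nat (val a).
  by apply: sub_in_pnat (valP a) => q _; rewrite inE => /eqP ->.
rewrite -exprNn_pchar // -exprDn_pchar // expf_eq0 => /andP[_].
by rewrite subr_eq0 => /eqP.
Qed.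

Fact pin_frob_proof (a : exponent p) (P : Xdot_pin p) :
  (frob (val a) (val P) : Xdot) \in Xdot_pin p.
Proof.
have PP := set_mem (valP P); have a0 := exponent_gt0 a.
apply/mem_set; split; last exact: PP.2.
move=> x y /set_mem[n n0 xn] /set_mem[m m0 ym] /=; rewrite /frob_chi.
have nz (z : kappa (pt (val P))) k : (0 < k)%N -> z ^+ k = 1 -> z != 0.
  move=> k0 zk; apply/eqP => z0; move: zk; rewrite z0 expr0n gtn_eqF // => /eqP.
  by rewrite eq_sym oner_eq0.
rewrite (negPf (nz _ _ n0 xn)) (negPf (nz _ _ m0 ym)) => h.
apply: (pin_expr_inj (a := a) PP); apply: PP.1 => //; apply/mem_set.
  by exists n => //; rewrite exprAC xn expr1n.
by exists m => //; rewrite exprAC ym expr1n.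
Qed.
Definition pin_frob (a : exponent p) (P : Xdot_pin p) : Xdot_pin p :=
  exist (fun y => y \in Xdot_pin p) _ (pin_frob_proof a P).

Fact pin_frob1 P : pin_frob (one_exponent p) P = P.
Proof. by apply: val_inj; exact: frob1. Qed.
Fact pin_frobM a b P : pin_frob (mul_exponent a b) P = pin_frob a (pin_frob b P).
Proof. by apply: val_inj; apply: frobM; exact: exponent_gt0. Qed.
Fact pin_frob_inj a : injective (pin_frob a).
Proof. by move=> P Q /(congr1 val)/(frob_inj (exponent_gt0 a)) /val_inj. Qed.
Fact pin_frob_surj a P : exists Q, pin_frob a Q = P.
Proof.
have PP := set_mem (valP P).
have [z z1|Q EQ FQ] := @frob_divide _ _ _ _ _ _ _ (val P) (exponent_gt0 a).
  suff -> : z = 1 by exact: chi1.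
  by apply: (pin_expr_inj (a := a) PP); rewrite z1 expr1n.
suff hQ : Q \in Xdot_pin p by exists (exist (fun y => y \in Xdot_pin p) Q hQ); exact: val_inj.
apply/mem_set; split; last by rewrite EQ; exact: PP.2.
have : inj_set ff iota C (frob (val a) Q) by rewrite FQ; exact: PP.1.
move=> h x y hx hy xy; apply: (h) => //=; rewrite /frob_chi !chiX xy.
by rewrite -!chi_eq0 xy.
Qed.

(* p^Z acting on Xdot_pin with p acting by F_p *)
Definition pin_action : fraction_action p (Xdot_pin p) :=
  FractionAction pin_frob1 pin_frobM pin_frob_inj pin_frob_surj.

Lemma pin_action_orbit a P Q :
  orbit_equiv (Xdot_pin p) (pin_action a P) (pin_action a Q) <->
  orbit_equiv (Xdot_pin p) P Q.
Proof.
have a0 := exponent_gt0 a; split=> -[g h]; exists g.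
  by apply: (frob_inj a0); rewrite [LHS]h /= gal_frob.
by rewrite /= h gal_frob.
Qed.

Definition pin0_action : fraction_action p (mod_gal (Xdot_pin p)) :=
  quot_action pin_action_orbit.
End FrobeniusAction.

Section Colimit.
Variable N : nat_pred.

(* (nu, P) stands for P in the copy of Xdot with index nu, i.e. for F_nu^-1 P;
   two elements are identified when they agree at a common multiple. *)
Definition colim_rel (x y : {nu : exponent N & Xdot}) : Prop :=
  exists a b : exponent N,
    mul_exponent (projT1 x) a = mul_exponent (projT1 y) b /\
    frob (val a) (projT2 x) = frob (val b) (projT2 y).

Lemma exponent_frobM (a b : exponent N) (P : Xdot) :
  frob (val (mul_exponent a b)) P = frob (val a) (frob (val b) P).
Proof. by apply: frobM; exact: exponent_gt0. Qed.

Fact colim_refl x : colim_rel x x.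
Proof. by exists (one_exponent N), (one_exponent N). Qed.
Fact colim_sym x y : colim_rel x y -> colim_rel y x.
Proof. by move=> [a [b [h k]]]; exists b, a. Qed.
Fact colim_trans x y z : colim_rel x y -> colim_rel y z -> colim_rel x z.
Proof.
move=> [a [b [h k]]] [c [d [h' k']]].
exists (mul_exponent c a), (mul_exponent b d); split; last first.
  by rewrite !exponent_frobM k -exponent_frobM mul_exponentC exponent_frobM k'.
apply: val_inj; move/(congr1 val): h => /= h; move/(congr1 val): h' => /= h'.
by rewrite [(val c * _)%N]mulnC mulnA h -mulnA [(val b * _)%N]mulnC mulnA h' -mulnA [(val d * _)%N]mulnC.
Qed.

Definition colim_equiv := Equivalence colim_refl colim_sym colim_trans.

(* The quotient topology from the disjoint union of the copies of Xdot is the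
   inductive limit topology. *)
Definition Xcheck : topologicalType := quot colim_equiv.

(* F_nu^-1 P *)
Definition cpt (nu : exponent N) (P : Xdot) : Xcheck :=
  cls colim_equiv (existT (fun _ => Xdot) nu P).

Lemma cpt_eqP nu P mu Q :
  cpt nu P = cpt mu Q <-> frob (val mu) P = frob (val nu) Q.
Proof.
rewrite /cpt cls_eqP; split=> [[a [b [/(congr1 val) /= E h]]]|h]; last first.
  by exists mu, nu; rewrite mul_exponentC.
apply: (frob_inj (exponent_gt0 a)); rewrite -!exponent_frobM.
have -> : mul_exponent a nu = mul_exponent b mu by apply: val_inj; rewrite /= mulnC E mulnC.
by rewrite mul_exponentC !exponent_frobM h -!exponent_frobM mul_exponentC.
Qed.

Definition Xcheck_frob (a : exponent N) (z : Xcheck) : Xcheck :=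
  cpt (projT1 (cls_repr z)) (frob (val a) (projT2 (cls_repr z))).

Definition Xcheck_gal (g : galois_aut iota) (z : Xcheck) : Xcheck :=
  cpt (projT1 (cls_repr z)) (gal_char g (projT2 (cls_repr z))).

Lemma cptP (z : Xcheck) : exists nu P, z = cpt nu P.
Proof.
exists (projT1 (cls_repr z)), (projT2 (cls_repr z)).
by rewrite -[LHS]cls_reprK /cpt -sigT_eta.
Qed.

Lemma Xcheck_frobE a nu P : Xcheck_frob a (cpt nu P) = cpt nu (frob (val a) P).
Proof.
rewrite /Xcheck_frob; set w := cls_repr _.
have /cpt_eqP h : cpt (projT1 w) (projT2 w) = cpt nu P by rewrite /cpt -sigT_eta cls_reprK.
by apply/cpt_eqP; rewrite -!exponent_frobM mul_exponentC exponent_frobM h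
  -exponent_frobM mul_exponentC exponent_frobM.
Qed.

Lemma Xcheck_galE g nu P : Xcheck_gal g (cpt nu P) = cpt nu (gal_char g P).
Proof.
rewrite /Xcheck_gal; set w := cls_repr _.
have /cpt_eqP h : cpt (projT1 w) (projT2 w) = cpt nu P by rewrite /cpt -sigT_eta cls_reprK.
by apply/cpt_eqP; rewrite -!gal_frob ?exponent_gt0 // h.
Qed.

Definition Xcheck_tors : set Xcheck :=
  [set z | exists nu P, tors_set ff iota C N P /\ z = cpt nu P].

Fact tors_frob_proof a (z : Xcheck_tors) : Xcheck_frob a (val z) \in Xcheck_tors.
Proof.
have [nu [P [hP ->]]] := set_mem (valP z); apply/mem_set.
exists nu, (frob (val a) P); rewrite Xcheck_frobE; split=> //.
by apply: tors_set_frob hP; exact: (valP a).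
Qed.
Definition tors_frob a (z : Xcheck_tors) : Xcheck_tors :=
  exist (fun y => y \in Xcheck_tors) _ (tors_frob_proof a z).

Fact tors_frob1 z : tors_frob (one_exponent N) z = z.
Proof.
apply: val_inj => /=; have [nu [P ->]] := cptP (val z).
by rewrite Xcheck_frobE frob1.
Qed.
Fact tors_frobM a b z : tors_frob (mul_exponent a b) z = tors_frob a (tors_frob b z).
Proof.
apply: val_inj => /=; have [nu [P ->]] := cptP (val z).
by rewrite !Xcheck_frobE exponent_frobM.
Qed.
Fact tors_frob_inj a : injective (tors_frob a).
Proof.
move=> z w /(congr1 val) /=; have [nu [P Ez]] := cptP (val z).
have [mu [Q Ew]] := cptP (val w); rewrite Ez Ew !Xcheck_frobE => /cpt_eqP h.
apply: val_inj; rewrite [LHS]Ez [RHS]Ew; apply/cpt_eqP.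
apply: (frob_inj (exponent_gt0 a)).
by rewrite -!exponent_frobM mul_exponentC exponent_frobM h -exponent_frobM mul_exponentC exponent_frobM.
Qed.
Fact tors_frob_surj a z : exists w, tors_frob a w = z.
Proof.
have [nu [P [hP E]]] := set_mem (valP z).
have hw : cpt (mul_exponent a nu) P \in Xcheck_tors.
  by apply/mem_set; exists (mul_exponent a nu), P.
exists (exist (fun y => y \in Xcheck_tors) _ hw); apply: val_inj; rewrite /= E Xcheck_frobE.
by apply/cpt_eqP; rewrite -exponent_frobM mul_exponentC.
Qed.

Definition tors_action : fraction_action N Xcheck_tors :=
  FractionAction tors_frob1 tors_frobM tors_frob_inj tors_frob_surj.

Definition tors_orbit_rel (z w : Xcheck_tors) : Prop :=
  exists g : galois_aut iota, val w = Xcheck_gal g (val z).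

Fact tors_orbit_refl z : tors_orbit_rel z z.
Proof.
exists (gal_id iota); have [nu [P ->]] := cptP (val z).
by rewrite Xcheck_galE gal_char_id.
Qed.
Fact tors_orbit_sym z w : tors_orbit_rel z w -> tors_orbit_rel w z.
Proof.
move=> [g E]; have [h hK] := gal_char_inv ff C g; exists h; rewrite E.
by have [nu [P ->]] := cptP (val z); rewrite !Xcheck_galE hK.
Qed.
Fact tors_orbit_trans z w t :
  tors_orbit_rel z w -> tors_orbit_rel w t -> tors_orbit_rel z t.
Proof.
move=> [g E] [h E']; exists (gal_comp g h); rewrite E' E.
by have [nu [P ->]] := cptP (val z); rewrite !Xcheck_galE gal_char_comp.
Qed.

Definition tors_orbit_equiv :=
  Equivalence tors_orbit_refl tors_orbit_sym tors_orbit_trans.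

Definition Xcheck0_tors : topologicalType := quot tors_orbit_equiv.

Lemma tors_action_orbit a z w :
  tors_orbit_equiv (tors_action a z) (tors_action a w) <-> tors_orbit_equiv z w.
Proof.
split=> -[g] /=; have [nu [P Ez]] := cptP (val z); have [mu [Q Ew]] := cptP (val w).
  rewrite Ez Ew !(Xcheck_frobE, Xcheck_galE) => /cpt_eqP h; exists g.
  rewrite Ez Ew Xcheck_galE; apply/cpt_eqP; apply: (frob_inj (exponent_gt0 a)).
  rewrite -!exponent_frobM mul_exponentC exponent_frobM h gal_frob ?exponent_gt0 //.
  by rewrite -!exponent_frobM mul_exponentC.
rewrite Ez Ew Xcheck_galE => /cpt_eqP h; exists g => /=.
rewrite Ez Ew !(Xcheck_frobE, Xcheck_galE); apply/cpt_eqP.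
rewrite gal_frob ?exponent_gt0 // -!exponent_frobM mul_exponentC exponent_frobM h.
by rewrite -exponent_frobM mul_exponentC exponent_frobM.
Qed.

Definition tors0_action : fraction_action N Xcheck0_tors :=
  quot_action tors_action_orbit.

Fact in_tors_proof P : Xdot_in P -> cpt (one_exponent N) P \in Xcheck_tors.
Proof.
by move=> hP; apply/mem_set; exists (one_exponent N), P; split=> //; exact: inj_set_tors.
Qed.

Definition Qin_tors (P : Xdot_Qin) : Xcheck_tors :=
  exist (fun y => y \in Xcheck_tors) _ (in_tors_proof (set_mem (valP P)).1).
Definition pin_tors p (P : Xdot_pin p) : Xcheck_tors :=
  exist (fun y => y \in Xcheck_tors) _ (in_tors_proof (set_mem (valP P)).1).

Definition charX0 : Type := set_type (residue_chars ff).

Definition target : topologicalType := twisted_product R tors_action.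
Definition target0 : topologicalType := twisted_product R tors0_action.

Definition summand (i : option charX0) : topologicalType :=
  if i is Some p then twisted_product R (pin_action (val p))
  else (Xdot_Qin * Rpos R)%type.

Definition summand0 (i : option charX0) : topologicalType :=
  if i is Some p then twisted_product R (pin0_action (val p))
  else (mod_gal Xdot_Qin * Rpos R)%type.

Definition source : topologicalType := {i : option charX0 & summand i}.
Definition source0 : topologicalType := {i : option charX0 & summand0 i}.

Definition source_Q (P : Xdot_Qin) (u : Rpos R) : source :=
  existT summand None (P, u).
Definition source_p (p : charX0) (P : Xdot_pin (val p)) (u : Rpos R) : source :=
  existT summand (Some p) (tw (pin_action (val p)) P u).
Definition source0_Q (P : mod_gal Xdot_Qin) (u : Rpos R) : source0 :=
  existT summand0 None (P, u).
Definition source0_p (p : charX0) (P : mod_gal (Xdot_pin (val p))) (u : Rpos R) :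
    source0 :=
  existT summand0 (Some p) (tw (pin0_action (val p)) P u).

Definition summand_scale (i : option charX0) (v : Rpos R) :
    summand i -> summand i :=
  match i with
  | None => fun x => (x.1, Rpos_mul x.2 v)
  | Some p => fun x => tw_scale x v
  end.
Definition summand0_scale (i : option charX0) (v : Rpos R) :
    summand0 i -> summand0 i :=
  match i with
  | None => fun x => (x.1, Rpos_mul x.2 v)
  | Some p => fun x => tw_scale x v
  end.

Definition source_scale (x : source) (v : Rpos R) : source :=
  existT summand (projT1 x) (summand_scale v (projT2 x)).
Definition source0_scale (x : source0) (v : Rpos R) : source0 :=
  existT summand0 (projT1 x) (summand0_scale v (projT2 x)).

End Colimit.
End Spaces.

Arguments Xdot_Qin {X0 K0} ff {K} iota {R} C _.
Arguments Xdot_pin {X0 K0} ff {K} iota {R} C p _.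
Arguments Xcheck_tors {X0 K0} ff {K} iota {R} C N _.

(* Main.v *)
(** A point of the colimit over a torsion-finite character P has the form
F_nu^-1 F_n Q, where n is the order of the torsion of ker P and Q is injective
on roots of unity: residue fields of the normalization contain all roots, so a
character trivial on the n-th roots of unity factors through the n-th power map.
Hence every R^{>0}-orbit meets the injective characters.  Conversely, if
F_a P = F_b Q with P and Q injective on roots of unity, then P and Q live over
the same point x and the a-th and b-th roots of unity of kappa(x) agree.  Since
kappa(x) has exactly n distinct n-th roots of unity for n prime to its
characteristic, a = b in characteristic 0, and a and b have the same
prime-to-p part in characteristic p; what remains is the action of p^Z. *)

From HB Require Import structures.
Require Import Defs.
From mathcomp Require Import all_boot all_order all_algebra.
From mathcomp Require Import separable.
From mathcomp Require Import all_classical reals topology.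

Set Implicit Arguments.
Unset Strict Implicit.
Unset Printing Implicit Defensive.
Import Order.TTheory GRing.Theory Num.Theory.
Local Open Scope classical_set_scope.
Local Open Scope ring_scope.

(** * Continuous maps out of quotient spaces *)

Section QuotContinuity.
Variables (T : topologicalType) (E : equivalence T).

Lemma cls_continuous : continuous (cls E).
Proof. exact: pi_continuous. Qed.

Lemma quot_continuous (Z : topologicalType) (f : quot E -> Z) :
  continuous (fun x => f (cls E x)) -> continuous f.
Proof. by move=> h; apply/quotient_continuous. Qed.

End QuotContinuity.

(* What the maps [jQ] and [jp] into a space [M] acted on by Q must satisfy for
   MQ x R^{>0} and the Mp x_{p^Z} R^{>0} to add up to M x_Q R^{>0}. *)
Record decomposition (N : nat_pred) (M : topologicalType)
    (F : fraction_action N M) (MQ : topologicalType) (jQ : MQ -> M)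
    (I : choiceType) (p : I -> nat) (Mp : I -> topologicalType)
    (Fp : forall i, fraction_action (p i) (Mp i)) (jp : forall i, Mp i -> M) :
    Prop := Decomposition {
  jQ_continuous : continuous jQ;
  jp_continuous : forall i, continuous (jp i);
  jp_equivariant : forall i (c : exponent (p i)) m,
    exists2 a : exponent N, val a = val c & jp i (Fp i c m) = F a (jp i m);
  jQ_inj : forall a b m m', F a (jQ m) = F b (jQ m') -> a = b /\ m = m';
  jp_inj : forall i a b (m m' : Mp i), F a (jp i m) = F b (jp i m') ->
    exists c d : exponent (p i),
      Fp i c m = Fp i d m' /\ (val a * val d = val b * val c)%N;
  jQp_disjoint : forall i a b m (m' : Mp i), F a (jQ m) <> F b (jp i m');
  jpp_disjoint : forall i i' a b (m : Mp i) (m' : Mp i'),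
    F a (jp i m) = F b (jp i' m') -> i = i';
  j_cover : forall x, exists a b,
    (exists m, F a x = F b (jQ m)) \/ (exists i (m : Mp i), F a x = F b (jp i m)) }.

(** * Gluing twisted products along a decomposition *)

Section TwistedSum.
Variables (R : realType) (N : nat_pred) (M : topologicalType).
Variables (F : fraction_action N M) (MQ : topologicalType) (jQ : MQ -> M).
Variables (I : choiceType) (p : I -> nat) (Mp : I -> topologicalType).
Variables (Fp : forall i, fraction_action (p i) (Mp i)).
Variables (jp : forall i, Mp i -> M).
Hypothesis D : decomposition F jQ Fp jp.

(** Shaped so that, for the injective characters and for their Galois orbits, the sum of these
    spaces unfolds to [source] and to [source0]. *)
Definition twisted_summand (i : option I) : topologicalType :=
  if i is Some i then twisted_product R (Fp i) else (MQ * Rpos R)%type.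

Definition twisted_summand_scale (i : option I) (v : Rpos R) :
    twisted_summand i -> twisted_summand i :=
  match i with
  | None => fun x => (x.1, Rpos_mul x.2 v)
  | Some i => fun x => tw_scale x v
  end.

Definition twisted_summand_map (i : option I) :
    twisted_summand i -> twisted_product R F :=
  match i with
  | None => fun x => tw F (jQ x.1) x.2
  | Some i => fun x => tw F (jp (cls_repr x).1) (cls_repr x).2
  end.

Lemma exponent_neq0 (N' : nat_pred) (a : exponent N') : (val a)%:R != 0 :> R.
Proof. by rewrite pnatr_eq0 -lt0n exponent_gt0. Qed.

Lemma tw_surj (N' : nat_pred) (M' : topologicalType) (F' : fraction_action N' M')
  (z : twisted_product R F') : exists m u, z = tw F' m u.
Proof.
exists (cls_repr z).1, (cls_repr z).2.
by rewrite -[LHS]cls_reprK /tw -surjective_pairing.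
Qed.

(** The chosen representative of the class of [(m, u)] differs from [(m, u)] by a quotient of two
    exponents for [p i]. By equivariance these act on [M] through exponents for [N] with the same
    values, so the class over [M] does not change. *)
Lemma twisted_summand_map_tw i (m : Mp i) u :
  @twisted_summand_map (Some i) (tw (Fp i) m u) = tw F (jp m) u.
Proof.
apply/cls_eqP => /=; have [c [d [/= h k]]] :=
  (cls_eqP _ _ _).1 (cls_reprK (tw (Fp i) m u)).
have [a ac Ea] := jp_equivariant D c (cls_repr (tw (Fp i) m u)).1.
have [b bd Eb] := jp_equivariant D d m.
by exists a, b; split=> /=; rewrite -?Ea -?Eb ?h // ac bd.
Qed.

Lemma twisted_summand_map_continuous i : continuous (@twisted_summand_map i).
Proof.
have jtw (Z : topologicalType) (j : Z -> M) : continuous j ->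
    continuous (fun x : Z * Rpos R => tw F (j x.1) x.2).
  move=> cj x; apply: (@continuous_comp _ _ _ (fun x => (j x.1, x.2)) (cls _)).
    have j1 : (fun y : Z * Rpos R => j y.1) @ x --> j x.1.
      by apply: (@continuous_comp _ _ _ fst j); [exact: cvg_fst|exact: cj].
    exact: (cvg_pair j1 cvg_snd).
  exact: cls_continuous.
case: i => [i|]; last exact: jtw (jQ_continuous D).
(* The map is defined through representatives; before the quotient it has an explicit formula, and
   continuity is tested there. *)
apply: quot_continuous.
rewrite (_ : (fun x => _) = (fun x => tw F (@jp i x.1) x.2)).
  exact: jtw (jp_continuous D (i := i)).
by apply/funext => -[m u]; exact: twisted_summand_map_tw.
Qed.

Definition twisted_sum_map (x : {i : option I & twisted_summand i}) :
  twisted_product R F := twisted_summand_map (projT2 x).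

Lemma twisted_sum_map_Q m u :
  twisted_sum_map (existT twisted_summand None (m, u)) = tw F (jQ m) u.
Proof. by []. Qed.

Lemma twisted_sum_map_p i (m : Mp i) u :
  twisted_sum_map (existT twisted_summand (Some i) (tw (Fp i) m u)) =
  tw F (jp m) u.
Proof. exact: twisted_summand_map_tw. Qed.

Lemma twisted_sumP (x : {i : option I & twisted_summand i}) :
  (exists m u, x = existT twisted_summand None (m, u)) \/
  (exists i (m : Mp i) u, x = existT twisted_summand (Some i) (tw (Fp i) m u)).
Proof.
case: x => -[i|] x; last by left; exists x.1, x.2; case: x.
by right; have [m [u ->]] := tw_surj x; exists i, m, u.
Qed.

Lemma twisted_sum_map_scale (x : {i : option I & twisted_summand i}) v :
  twisted_sum_map (existT twisted_summand (projT1 x)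
    (twisted_summand_scale v (projT2 x))) = tw_scale (twisted_sum_map x) v.
Proof.
have [[m [u ->]]|[i [m [u ->]]]] := twisted_sumP x.
  by rewrite twisted_sum_map_Q tw_scaleE.
by rewrite [twisted_summand_scale _ _]tw_scaleE !twisted_sum_map_p tw_scaleE.
Qed.

Lemma twisted_sum_map_inj : injective twisted_sum_map.
Proof.
move=> x x'; have [[m [u ->]]|[i [m [u ->]]]] := twisted_sumP x;
  have [[m' [u' ->]]|[i' [m' [u' ->]]]] := twisted_sumP x';
  rewrite ?twisted_sum_map_Q ?twisted_sum_map_p => /cls_eqP[a [b [/= h k]]].
- have [E ->] := jQ_inj D h; move: k; rewrite E => k.
  by have -> : u' = u by apply: val_inj; exact: mulfI (exponent_neq0 b) _ _ k.
- by case: (jQp_disjoint D h).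
- by case: (jQp_disjoint D (esym h)).
- have E := jpp_disjoint D h; case: i' / E m' h => m' h.
  have [c [d [hm hab]]] := jp_inj D h.
  congr existT; apply/cls_eqP; exists c, d; split=> //=.
  (* After multiplication by a the claim reads a c u' = c b u = a d u, the last equality being
     [hab]. *)
  apply: (mulfI (exponent_neq0 a)); rewrite mulrCA k mulrCA mulrA -natrM.
  rewrite [RHS]mulrA -natrM.
  exact: (congr1 (fun e : nat => e%:R * val u) (esym hab)).
Qed.

Lemma twisted_sum_map_surj y : exists x, twisted_sum_map x = y.
Proof.
have [m [u ->]] := tw_surj y; have [a [b ab]] := j_cover D m.
(* Given F_a m = F_b (j m'), the pairs (m, u) and (j m', v) have the same class once b u = a v,
   which forces this v. *)
have v0 : (val b)%:R / (val a)%:R * val u \in [set u : R | 0 < u].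
  apply/mem_set; rewrite /= mulr_gt0 ?(set_mem (valP u)) //.
  by rewrite divr_gt0 // ltr0n exponent_gt0.
pose v : Rpos R := exist (fun w => w \in [set u : R | 0 < u]) _ v0.
have av : (val b)%:R * val u = (val a)%:R * val v.
  by rewrite /= mulrA mulrCA divff ?exponent_neq0 // mulr1.
case: ab => [[m' h]|[i [m' h]]].
  exists (existT twisted_summand None (m', v)).
  by apply/cls_eqP; exists b, a; rewrite h.
exists (existT twisted_summand (Some i) (tw (Fp i) m' v)).
by rewrite twisted_sum_map_p; apply/cls_eqP; exists b, a; rewrite h.
Qed.

Lemma decomposition_bijection :
  exists phi : {i : option I & twisted_summand i} -> twisted_product R F,
    [/\ forall m u, phi (existT twisted_summand None (m, u)) = tw F (jQ m) u,
        forall i (m : Mp i) u,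
          phi (existT twisted_summand (Some i) (tw (Fp i) m u)) = tw F (jp m) u,
        forall x v, phi (existT twisted_summand (projT1 x)
          (twisted_summand_scale v (projT2 x))) = tw_scale (phi x) v,
        continuous phi &
        bijective phi].
Proof.
exists twisted_sum_map; split=> //.
- exact: twisted_sum_map_p.
- exact: twisted_sum_map_scale.
- exact/sigT_continuous/twisted_summand_map_continuous.
- have [g gK] := choice twisted_sum_map_surj.
  exists g => // x; apply: twisted_sum_map_inj; exact: gK.
Qed.

End TwistedSum.

(** * Descent of a decomposition to quotient spaces *)

Section Descent.
Variables (N : nat_pred) (M : topologicalType).
Variables (F : fraction_action N M) (MQ : topologicalType) (jQ : MQ -> M).
Variables (I : choiceType) (p : I -> nat) (Mp : I -> topologicalType).
Variables (Fp : forall i, fraction_action (p i) (Mp i)).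
Variables (jp : forall i, Mp i -> M).
Variables (E : equivalence M) (EQ : equivalence MQ).
Variables (Ep : forall i, equivalence (Mp i)).
Hypothesis FE : forall a x y, E (F a x) (F a y) <-> E x y.
Hypothesis FpE : forall i a x y, Ep i (Fp i a x) (Fp i a y) <-> Ep i x y.
Hypothesis jQE : forall m m', EQ m m' -> E (jQ m) (jQ m').
Hypothesis jpE : forall i m m', Ep i m m' -> E (jp m) (jp m').
Hypothesis jQ_lift : forall m y, E (jQ m) y -> exists2 m', EQ m m' & jQ m' = y.
Hypothesis jp_lift : forall i m y, E (jp m) y ->
  exists2 m', Ep i m m' & jp m' = y.

Definition quot_map (A B : topologicalType) (EA : equivalence A)
  (EB : equivalence B) (j : A -> B) (z : quot EA) : quot EB := cls EB (j (cls_repr z)).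

Lemma quot_mapE (A B : topologicalType) (EA : equivalence A)
  (EB : equivalence B) (j : A -> B) : (forall m m', EA m m' -> EB (j m) (j m')) ->
  forall m, quot_map EB j (cls EA m) = cls EB (j m).
Proof. by move=> h m; apply/cls_eqP/h/cls_reprE. Qed.

Lemma quot_map_continuous (A B : topologicalType) (EA : equivalence A)
  (EB : equivalence B) (j : A -> B) : (forall m m', EA m m' -> EB (j m) (j m')) ->
  continuous j -> continuous (@quot_map _ _ EA EB j).
Proof.
move=> h cj; apply: quot_continuous.
rewrite (_ : (fun x => _) = cls EB \o j); last by apply/funext => x; exact: quot_mapE.
by move=> x; apply: continuous_comp; [exact: cj|exact: cls_continuous].
Qed.

(** Surjectivity of F_a lets F_b y be written as F_a x', and [FE] cancels F_a. An equivalence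
    between two translates thus becomes an equality after moving x in its class. *)
Lemma orbit_shift a b x y : E (F a x) (F b y) ->
  exists2 x', E x x' & F a x' = F b y.
Proof. by have [x' <-] := fact_surj F a (F b y); move=> /FE; exists x'. Qed.

(** Equalities of classes are turned by [orbit_shift] into equalities in [M]; the lifting hypotheses
    bring the moved element back into the image of [jQ] or [jp], where the given decomposition
    applies. *)
Lemma decomposition_quot : decomposition F jQ Fp jp ->
  decomposition (quot_action FE) (quot_map E jQ (EA := EQ))
    (fun i => quot_action (FpE (i := i)))
    (fun i => quot_map E (@jp i) (EA := Ep i)).
Proof.
move=> D; have jQEq := quot_mapE jQE; have jpEq i := quot_mapE (jpE (i := i)).
have qF a x : quot_action FE a (cls E x) = cls E (F a x) by exact: quot_factE.
have qFp i c m : quot_action (FpE (i := i)) c (cls (Ep i) m) = cls (Ep i) (Fp i c m).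
  exact: quot_factE.
have Erepr (T : topologicalType) (e : equivalence T) (z : quot e) :
  exists t, z = cls e t by exists (cls_repr z); rewrite cls_reprK.
split.
- exact: quot_map_continuous (jQ_continuous D).
- by move=> i; apply: quot_map_continuous (jp_continuous D (i := i)) => m m'; exact: jpE.
- move=> i c z; have [m ->] := Erepr _ _ z.
  have [a ac h] := jp_equivariant D c m; exists a => //.
  by rewrite qFp !jpEq qF h.
- move=> a b z z'; have [m ->] := Erepr _ _ z; have [m' ->] := Erepr _ _ z'.
  rewrite !jQEq !qF => /cls_eqP/orbit_shift[y].
  move=> /jQ_lift[n mn <-] /(jQ_inj D)[-> <-]; split=> //; exact/cls_eqP.
- move=> i a b z z'; have [m ->] := Erepr _ _ z; have [m' ->] := Erepr _ _ z'.
  rewrite !jpEq !qF => /cls_eqP/orbit_shift[y].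
  move=> /jp_lift[n mn <-] /(jp_inj D)[c [d [h k]]]; exists c, d; split=> //.
  by rewrite !qFp -h; apply/cls_eqP/FpE.
- move=> i a b z z'; have [m ->] := Erepr _ _ z; have [m' ->] := Erepr _ _ z'.
  rewrite jQEq jpEq !qF => /cls_eqP/orbit_shift[y].
  by move=> /jQ_lift[n mn <-] /(jQp_disjoint D).
- move=> i i' a b z z'; have [m ->] := Erepr _ _ z; have [m' ->] := Erepr _ _ z'.
  rewrite !jpEq !qF => /cls_eqP/orbit_shift[y].
  by move=> /jp_lift[n mn <-] /(jpp_disjoint D).
- move=> z; have [x ->] := Erepr _ _ z.
  have [a [b [[m h]|[i [m h]]]]] := j_cover D x; exists a, b; [left|right; exists i];
    exists (cls _ m); rewrite ?jQEq ?jpEq !qF h //.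
Qed.

End Descent.

(** * Roots of unity in the residue fields *)

Lemma separable_Xn_sub_1 (R : idomainType) n :
  n%:R != 0 :> R -> separable_poly ('X^n - 1 : {poly R}).
Proof.
(* The combination n (X^n - 1) - X (n X^(n-1)) is the nonzero constant -n. *)
move=> n0; rewrite unlock; apply/Bezout_coprimepP; exists (n%:R%:P, - 'X).
rewrite derivB derivXn derivC subr0 /=.
case: n n0 => [|n] n0; first by rewrite eqxx in n0.
rewrite mulNr mulrnAr -exprS mulrBr mulr1 rmorph_nat mulr_natl addrAC subrr add0r.
by rewrite -(rmorph_nat polyC) -polyCN polyC_eqp1 oppr_eq0.
Qed.

Lemma map_Xn_sub_1 (A B : nzRingType) (f : {rmorphism A -> B}) n :
  map_poly f ('X^n - 1) = 'X^n - 1.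
Proof. by rewrite rmorphB rmorph1 /= map_polyXn. Qed.

Section ResidueFieldRoots.
Variables (X0 : ringed_space) (K0 : fieldType) (ff : function_field X0 K0).
Variables (K : closedFieldType) (iota : {rmorphism K0 -> K}).
Variable x : Defs.point ff iota.

(* The factorization of X^n - 1 over K is defined over the integral closure and
   reduces to one over kappa x, where X^n - 1 is still separable. *)
Lemma kappa_unity_roots n : n%:R != 0 :> kappa x ->
  exists rs : seq (kappa x),
    [/\ uniq rs, all n.-unity_root rs & size rs = n].
Proof.
move=> nx; have n0 : (0 < n)%N by case: n nx => //; rewrite eqxx.
have [rs Ers] := closed_field_poly_normal ('X^n - 1 : {poly K}).
have := lead_coefXnsubC (1 : K) n0; rewrite polyC1 => l1.
move: Ers; rewrite l1 scale1r => Ers.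
pose A := integral_closure iota (stalk ff (base x)).
have rsA b : b \in rs -> (A : set K) b.
  move=> brs; have /rootP : root ('X^n - 1 : {poly K}) b by rewrite Ers root_prod_XsubC.
  move=> b1; apply: (@integral_root_monic _ _ (structure_map iota (S := stalk ff (base x)))
    b ('X^n - 1)); first by rewrite -polyC1 monicXnsubC.
    exact/rootP.
  apply/integral_poly => i; rewrite coefB coefXn coef1; apply: integral_sub;
    exact: integral_nat.
have [ts Ets] : exists ts : seq (ring_of A), rs = map val ts.
  elim: rs rsA {Ers} => [_|b rs IH h]; first by exists [::].
  have [c crs|ts ->] := IH; first by apply: h; rewrite inE crs orbT.
  by exists (to_ring (h b (mem_head _ _)) :: ts).
pose v : {rmorphism ring_of A -> K} := val.
have EA : 'X^n - 1 = \prod_(t <- ts) ('X - t%:P) :> {poly ring_of A}.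
  by apply: (map_inj_poly (f := v) val_inj (rmorph0 v));
    rewrite map_Xn_sub_1 map_prod_XsubC Ers Ets big_map.
pose r : {rmorphism ring_of A -> kappa x} := @residue _ _ _ _ _ x.
have Ek : 'X^n - 1 = \prod_(y <- map r ts) ('X - y%:P) :> {poly kappa x}.
  by rewrite big_map -map_prod_XsubC -EA map_Xn_sub_1.
exists (map r ts); split.
- by rewrite -separable_prod_XsubC -Ek separable_Xn_sub_1.
- apply/allP => y ys; apply/unity_rootP/eqP; rewrite -subr_eq0.
  have := root_prod_XsubC (map r ts) y; rewrite ys -Ek => /rootP.
  by rewrite hornerD hornerN hornerXn hornerC => ->.
- have := congr1 (fun p : {poly _} => size p) Ek.
  by rewrite size_prod_XsubC -polyC1 size_XnsubC // => -[].
Qed.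

(** The n distinct n-th roots of unity are all roots of X^m - 1, which has at most m roots. *)
Lemma kappa_exponent_leq n m : (0 < m)%N -> n%:R != 0 :> kappa x ->
  (forall z : kappa x, z ^+ n = 1 -> z ^+ m = 1) -> (n <= m)%N.
Proof.
move=> m0 /kappa_unity_roots[rs [Urs rsn szrs]] h.
have rsm : all m.-unity_root rs.
  by apply/allP => z /(allP rsn)/unity_rootP/h zm; exact/unity_rootP.
by move: (max_unity_roots m0 rsm Urs); rewrite szrs.
Qed.

End ResidueFieldRoots.

(** * The Galois action on residue fields *)

Section GalKappa.
Variables (X0 : ringed_space) (K0 : fieldType) (ff : function_field X0 K0).
Variables (K : fieldType) (iota : {rmorphism K0 -> K}).
Variables (x : Defs.point ff iota) (g : galois_aut iota).

(** The map is given by representatives, so it is computed on residues of lifts. Being a morphism of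
    fields, it is injective and preserves the characteristic, whence the Galois stability of the
    sets of injective characters. *)
Lemma gal_kappa_zmod : zmod_morphism (@gal_kappa _ _ _ _ _ x g).
Proof.
move=> y z; have [a <-] := residue_surj y; have [b <-] := residue_surj z.
by rewrite -rmorphB !gal_kappaE !rmorphB.
Qed.

Lemma gal_kappa_monoid : monoid_morphism (@gal_kappa _ _ _ _ _ x g).
Proof.
split=> [|y z]; first by rewrite -(rmorph1 (@residue _ _ _ _ _ _)) gal_kappaE !rmorph1.
have [a <-] := residue_surj y; have [b <-] := residue_surj z.
by rewrite -rmorphM !gal_kappaE !rmorphM.
Qed.

HB.instance Definition _ := GRing.isZmodMorphism.Build _ _
  (@gal_kappa _ _ _ _ _ x g) gal_kappa_zmod.
HB.instance Definition _ := GRing.isMonoidMorphism.Build _ _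
  (@gal_kappa _ _ _ _ _ x g) gal_kappa_monoid.

End GalKappa.

(** * Characters injective on roots of unity *)

Section InjectiveCharacters.
Variables (X0 : ringed_space) (K0 : fieldType) (ff : function_field X0 K0).
Variables (K : closedFieldType) (iota : {rmorphism K0 -> K}).
Variables (R : realType) (C : closed_valued_field R).
Local Notation char_point := (char_point ff iota C).

Lemma inj_set_gal g (P : char_point) :
  inj_set ff iota C P -> inj_set ff iota C (gal_char g P).
Proof.
pose h : {rmorphism kappa (gal_point (pt P) g) -> kappa (pt P)} :=
  @gal_kappa _ _ _ _ _ (pt P) g.
have hu y : y \in @Defs.root_of_unity (kappa (gal_point (pt P) g)) ->
    h y \in @Defs.root_of_unity (kappa (pt P)).
  by move=> /set_mem[n n0 yn]; apply/mem_set; exists n; rewrite // -rmorphXn yn rmorph1.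
move=> injP y z /hu hy /hu hz /(injP _ _ hy hz); exact: (fmorph_inj h).
Qed.

Lemma pchar_gal g (P : char_point) :
  [pchar (kappa (pt (gal_char g P)))] =i [pchar (kappa (pt P))].
Proof.
pose h : {rmorphism kappa (gal_point (pt P) g) -> kappa (pt P)} :=
  @gal_kappa _ _ _ _ _ (pt P) g.
by move=> p; exact/esym/(fmorph_pchar h).
Qed.

(** Since z^n is again a root of unity, injectivity detects whether it is 1. The torsion of the
    kernel of F_n P is therefore the group of n-th roots of unity. *)
Lemma chi_frob_eq1 (P : char_point) n (z : kappa (pt P)) : (0 < n)%N ->
  inj_set ff iota C P -> Defs.root_of_unity z ->
  @chi _ _ _ _ _ _ (frob n P) z = 1 <-> z ^+ n = 1.
Proof.
move=> n0 injP [k k0 zk]; rewrite /= /frob_chi.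
have [z0|_] := eqVneq z 0.
  by move/eqP: zk; rewrite z0 expr0n gtn_eqF // eq_sym oner_eq0.
split=> [h|->]; last exact: chi1.
apply: injP; rewrite ?h ?chi1 //; apply/mem_set; last by exists 1%N.
by exists k; rewrite // exprAC zk expr1n.
Qed.

Lemma frob_eq_expr (P Q : char_point) a b : (0 < a)%N -> (0 < b)%N ->
  inj_set ff iota C P -> inj_set ff iota C Q -> frob a P = frob b Q ->
  forall z : kappa (pt P), z ^+ a = 1 <-> z ^+ b = 1.
Proof.
move=> a0 b0 injP injQ E.
(* The points of P and Q agree only through [E], so the kernel is described over [frob b Q] and then
   rewritten along [E] into the residue field of P. *)
have kerQ (z : kappa (pt (frob b Q))) : Defs.root_of_unity z -> chi z = 1 <-> z ^+ b = 1.
  exact: (@chi_frob_eq1 Q b z b0 injQ).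
move: kerQ; rewrite -E => kerQ z; split=> hz.
  have hu : Defs.root_of_unity z by exists a.
  by apply/(kerQ z hu)/(@chi_frob_eq1 P a z a0 injP hu).
have hu : Defs.root_of_unity z by exists b.
by apply/(@chi_frob_eq1 P a z a0 injP hu)/(kerQ z hu).
Qed.

Lemma frob_eq_char0 (P Q : char_point) a b : (0 < a)%N -> (0 < b)%N ->
  inj_set_char0 ff iota C P -> inj_set_char0 ff iota C Q ->
  frob a P = frob b Q -> a = b.
Proof.
move=> a0 b0 [injP /pcharf0P char0] [injQ _] E.
have ab := frob_eq_expr a0 b0 injP injQ E.
have nz n : (0 < n)%N -> n%:R != 0 :> kappa (pt P) by rewrite char0 -lt0n.
by apply/anti_leq/andP; split; apply: (@kappa_exponent_leq _ _ _ _ _ (pt P)) => //;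
  [exact: nz|move=> z /ab|exact: nz|move=> z /ab].
Qed.

Lemma frob_eq_pchar p (P Q : char_point) a b : (0 < a)%N -> (0 < b)%N ->
  inj_set_char ff iota C p P -> inj_set_char ff iota C p Q ->
  frob a P = frob b Q -> (a`_p^' = b`_p^')%N.
Proof.
move=> a0 b0 pinP [injQ _] E; have [injP charP] := pinP.
have ab := frob_eq_expr a0 b0 injP injQ E.
have le m n : (0 < m)%N -> (0 < n)%N ->
    (forall z : kappa (pt P), z ^+ m = 1 -> z ^+ n = 1) -> (m`_p^' <= n`_p^')%N.
  move=> m0 n0 h; apply: (@kappa_exponent_leq _ _ _ _ _ (pt P)).
  - exact: part_gt0.
  - rewrite -(dvdn_pcharf charP) -p'natE; last by case/andP: charP.
    exact: part_pnat.
  (* Raising to the p-part of n is injective in characteristic p, so z^n = 1 already gives the same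
     for the prime-to-p part of n. *)
  - pose c : exponent p := exist (fun e => (p : nat_pred).-nat e) _ (part_pnat p n).
    move=> z hz; apply: (pin_expr_inj (a := c) pinP).
    rewrite expr1n -exprM mulnC partnC //; apply: h.
    by rewrite -(partnC p m0) mulnC exprM hz expr1n.
by apply/anti_leq/andP; split; apply: le => // z /ab.
Qed.

(** F_a is F of the prime-to-p part of a after F of its p-part; the common first factor is cancelled
    by injectivity. *)
Lemma frob_eq_p_part p (P Q : char_point) a b : (0 < a)%N -> (0 < b)%N ->
  (a`_p^' = b`_p^')%N -> frob a P = frob b Q -> frob a`_p P = frob b`_p Q.
Proof.
move=> a0 b0 E FE; apply: (frob_inj (n := (b`_p^')%N)); first exact: part_gt0.
by rewrite -!frobM ?part_gt0 // -{1}E ![(_`_p^' * _)%N]mulnC !partnC.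
Qed.

Lemma tors_set_divide N (P : char_point) : tors_set ff iota C N P ->
  exists n Q, [/\ N.-nat n, inj_set ff iota C Q & frob n Q = P].
Proof.
move=> [n Nn /card_eq_uniq_seq[rs [Urs kerE szrs]]].
have n0 : (0 < n)%N by case/andP: Nn.
have rsP z : z \in rs <-> @ker_tors _ _ _ _ _ _ P z by rewrite kerE.
(* The torsion of the kernel is a group of order n, so its elements are killed by n. *)
have rsX z : z \in rs -> z ^+ n = 1.
  rewrite -szrs => zrs; apply: uniq_mul_closed_order => //.
    move=> y w /rsP[[i i0 yi] Py] /rsP[[j j0 wj] Pw]; apply/rsP; split.
      exists (i * j)%N; first by rewrite muln_gt0 i0.
      by rewrite exprMn exprM yi expr1n mulnC exprM wj expr1n mul1r.
    by rewrite chiM Py Pw mulr1.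
  by move=> y /rsP[_ Py]; rewrite -chi_eq0 Py oner_eq0.
(* An n-th root of unity outside the kernel would be an (n+1)-st root of X^n - 1. *)
have ker1 (z : kappa (pt P)) : z ^+ n = 1 -> chi z = 1.
  move=> zn; suff /rsP[] : z \in rs by [].
  apply: contraT => zrs; suff : (n < n)%N by rewrite ltnn.
  rewrite -{1}szrs -[X in (X <= _)%N]/(size (z :: rs)).
  apply: (@max_unity_roots (kappa (pt P))) => //; last by rewrite /= zrs.
  apply/allP => y; rewrite inE unity_rootE => /predU1P[->|/rsX ->] //.
  by rewrite zn.
have kerP (z : kappa (pt P)) : Defs.root_of_unity z -> chi z = 1 -> z ^+ n = 1.
  by move=> zu Pz; apply/rsX/rsP.
have [Q EQ FQ] := frob_divide n0 ker1; exists n, Q; split=> //.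
move: kerP; rewrite -FQ => kerQ y z /set_mem[i i0 yi] /set_mem[j j0 zj] yz.
have nz (w : kappa (pt Q)) m : (0 < m)%N -> w ^+ m = 1 -> w != 0.
  by move=> m0; apply: contra_eqN => /eqP ->; rewrite expr0n gtn_eqF // eq_sym oner_eq0.
have z0 := nz _ _ j0 zj; have Qz0 : chi z != 0 by rewrite chi_eq0.
(* F_n Q sends w to the value of Q at w^n = y / z, which is 1. As w is a root of unity, [kerQ]
   yields w^n = 1, that is y = z. *)
have [w wn] := kappa_root (y / z) n0.
have yz1 : chi (y / z) = 1.
  by apply: (mulIf Qz0); rewrite -chiM divfK // mul1r.
have w1 : (y / z) ^+ (i * j) = 1.
  by rewrite expr_div_n exprM yi mulnC exprM zj !expr1n divr1.
have ij0 : (0 < n * (i * j))%N by rewrite !muln_gt0 n0 i0.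
have wij : w ^+ (n * (i * j)) = 1 by rewrite exprM wn.
suff : w ^+ n = 1 by rewrite wn => yz1'; rewrite -[y](divfK z0) yz1' mul1r.
apply: kerQ; first by exists (n * (i * j))%N.
by rewrite /= /frob_chi (negPf (nz _ _ ij0 wij)) wn.
Qed.

End InjectiveCharacters.

(** * Injective characters inside the colimit *)

Section Spaces.
Variables (X0 : ringed_space) (K0 : fieldType) (ff : function_field X0 K0).
Variables (K : closedFieldType) (iota : {rmorphism K0 -> K}) (charN : nat_pred).
Variables (R : realType) (C : closed_valued_field R).
Hypothesis charN_residue : forall p, residue_chars ff p -> p \in charN.
Local Notation Xdot := (Xdot ff iota C).
Local Notation Xcheck_tors := (Xcheck_tors ff iota C charN).
Local Notation cpt1 := (@cpt _ _ ff _ iota _ C charN (one_exponent charN)).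

(** For the subspace topology only the composite into the colimit matters; it includes the copy of
    index 1 and then takes classes. *)
Lemma cpt1_continuous (S : set Xdot) (j : S -> Xcheck_tors) :
  (forall P, val (j P) = cpt1 (val P)) -> continuous j.
Proof.
move=> jE; apply: continuous_comp_initial.
rewrite (_ : _ \o j = cls (colim_equiv ff iota C charN) \o
  (existT (fun _ => Xdot) (one_exponent charN) \o val)); last exact/funext.
move=> P; apply: continuous_comp; last exact: cls_continuous.
by apply: continuous_comp; [exact: initial_continuous|exact: existT_continuous].
Qed.

Lemma tors_action_cpt1 a b (z w : Xcheck_tors) P Q :
  val z = cpt1 P -> val w = cpt1 Q ->
  tors_action ff iota C charN a z = tors_action ff iota C charN b w <->
  frob (val a) P = frob (val b) Q.
Proof.
move=> Ez Ew; split=> [/(congr1 val)|h]; last apply: val_inj;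
  rewrite /= ?Ez ?Ew !Xcheck_frobE; last by rewrite h.
by move=> /cpt_eqP; rewrite !frob1.
Qed.

(** If p vanishes in the residue field upstairs, it lies in a prime over the maximal ideal of the
    stalk, hence in that ideal. *)
Lemma residue_char_of_point (P : Xdot) p :
  p \in [pchar (kappa (pt P))] -> residue_chars ff p.
Proof.
case/andP=> pp p0; split=> //; exists (base (pt P)).
have [_] := @pt_over _ _ _ _ _ (pt P) p%:R; apply.
by rewrite -residue_eq0 !rmorph_nat.
Qed.

Lemma in_decomposition :
  decomposition (tors_action ff iota C charN) (Qin_tors charN)
    (fun p : charX0 ff => pin_action ff iota C (val p))
    (fun p : charX0 ff => @pin_tors _ _ ff _ iota R C charN (val p)).
Proof.
have gt0 := exponent_gt0.
split.
- exact: cpt1_continuous.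
- by move=> p; exact: cpt1_continuous.
- move=> p c P.
  (* Powers of a residue characteristic are exponents for [charN] by [charN_residue]. *)
  have pN : charN.-nat (val c).
    apply: sub_in_pnat (valP c) => q _; rewrite inE => /eqP ->.
    exact/charN_residue/(set_mem (valP p)).
  exists (exist (fun n => charN.-nat n) _ pN) => //; apply: val_inj.
  by rewrite /= Xcheck_frobE.
- move=> a b P Q /tors_action_cpt1 => /(_ _ _ erefl erefl) E.
  have ab : a = b.
    apply: val_inj; apply: frob_eq_char0 E; rewrite ?gt0 //; exact/set_mem/valP.
  split=> //; apply: val_inj; move: E; rewrite ab => E.
  exact: (frob_inj (gt0 _ b) E).
- move=> p a b P Q /tors_action_cpt1 => /(_ _ _ erefl erefl) E.
  have E' := frob_eq_pchar (gt0 _ _) (gt0 _ _) (set_mem (valP P)) (set_mem (valP Q)) E.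
  pose part (c : exponent charN) : exponent (val p) :=
    exist (fun n => (val p : nat_pred).-nat n) _ (part_pnat (val p) (val c)).
  (* The p-parts satisfy a b_p = b a_p because a and b have the same prime-to-p part. *)
  exists (part a), (part b).
  split; first by apply: val_inj; exact: frob_eq_p_part E' E.
  have Ea := partnC (val p) (gt0 _ a); have Eb := partnC (val p) (gt0 _ b).
  rewrite E' in Ea; rewrite /= -[X in (X * _)%N = _]Ea -[X in _ = (X * _)%N]Eb.
  by rewrite [LHS]mulnAC [RHS]mulnAC (mulnC (_`_(val p))%N).
- move=> p a b P Q /tors_action_cpt1 => /(_ _ _ erefl erefl) E.
  have [_ char0] := set_mem (valP P); have [_] := set_mem (valP Q).
  (* The maps F_n keep the underlying point, so P and Q share a residue field and its
     characteristic. *)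
  have /= EQ := congr1 (@pt _ _ _ _ _ _) E.
  by rewrite -EQ char0.
- move=> p q a b P Q /tors_action_cpt1 => /(_ _ _ erefl erefl) E.
  have [_ charp] := set_mem (valP P); have [_] := set_mem (valP Q).
  have /= EQ := congr1 (@pt _ _ _ _ _ _) E.
  rewrite -EQ (pcharf_eq charp) inE => /eqP qp.
  exact/val_inj/esym.
- move=> z; have [nu [P [hP Ez]]] := set_mem (valP z).
  have [n [Q [Nn injQ FQ]]] := tors_set_divide hP.
  pose c : exponent charN := exist (fun m => charN.-nat m) n Nn.
  (* Here z is F_nu^-1 P with P = F_n Q, so F_nu z = F_n Q. *)
  exists nu, c.
  have E (w : Xcheck_tors) : val w = cpt1 Q ->
      tors_action ff iota C charN nu z =
      tors_action ff iota C charN c w.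
    move=> Ew; apply: val_inj; rewrite /= Ez Ew !Xcheck_frobE -FQ.
    by apply/cpt_eqP; rewrite /= frob1.
  have [[p pQ]|no] := pselect (exists p, p \in [pchar (kappa (pt Q))]).
    have hp : p \in residue_chars ff by apply/mem_set; exact: residue_char_of_point pQ.
    have hQ : Q \in Xdot_pin ff iota C p by exact/mem_set.
    right; exists (exist (fun q => q \in residue_chars ff) p hp).
    by exists (exist (fun q => q \in Xdot_pin ff iota C p) Q hQ); exact: E.
  have hQ : Q \in Xdot_Qin ff iota C.
    apply/mem_set; split=> // p; apply/negbTE/negP => pQ.
    by apply: no; exists p.
  by left; exists (exist (fun q => q \in Xdot_Qin ff iota C) Q hQ); exact: E.
Qed.

Lemma orbit_map (S : set Xdot) (j : S -> Xcheck_tors) :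
  (forall P, val (j P) = cpt1 (val P)) -> forall P Q, orbit_equiv S P Q ->
  tors_orbit_equiv ff iota C charN (j P) (j Q).
Proof. by move=> jE P Q [g h]; exists g; rewrite !jE h Xcheck_galE. Qed.

(** The automorphism relating the two points of the colimit is applied to P itself; stability keeps
    the translate in [S]. *)
Lemma orbit_lift (S : set Xdot) (j : S -> Xcheck_tors) :
  (forall P, val (j P) = cpt1 (val P)) ->
  (forall g P, S P -> S (gal_char g P)) ->
  forall P y, tors_orbit_equiv ff iota C charN (j P) y ->
  exists2 Q, orbit_equiv S P Q & j Q = y.
Proof.
move=> jE Sg P y [g Ey].
have hQ : gal_char g (val P) \in S by apply/mem_set/Sg/set_mem/valP.
exists (exist (fun q => q \in S) _ hQ); first by exists g.
by apply: val_inj; rewrite Ey !jE Xcheck_galE.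
Qed.

Lemma in_decomposition0 :
  decomposition (tors0_action ff iota C charN)
    (quot_map (tors_orbit_equiv ff iota C charN) (Qin_tors charN)
      (EA := orbit_equiv (Xdot_Qin ff iota C)))
    (fun p : charX0 ff => pin0_action ff iota C (val p))
    (fun p : charX0 ff => quot_map (tors_orbit_equiv ff iota C charN)
      (@pin_tors _ _ ff _ iota R C charN (val p))
      (EA := orbit_equiv (Xdot_pin ff iota C (val p)))).
Proof.
apply: (decomposition_quot _ _ _ _ _ _ in_decomposition).
- exact: orbit_map.
- by move=> p; exact: orbit_map.
- apply: orbit_lift => [//|g P [injP char0]]; split; first exact: inj_set_gal.
  by move=> p; exact: etrans (pchar_gal g P p) (char0 p).
- move=> p; apply: orbit_lift => [//|g P [injP charP]]; split.
    exact: inj_set_gal.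
  exact: etrans (pchar_gal g P (val p)) charP.
Qed.

End Spaces.

Theorem theorem7p10 (X0 : ringed_space) (K0 : fieldType)
    (ff : function_field X0 K0) (K : closedFieldType)
    (iota : {rmorphism K0 -> K}) (charN : nat_pred)
    (R : realType) (C : closed_valued_field R)
    (X0_scheme : is_scheme X0) (X0_integral : is_integral X0)
    (X0_normal : is_normal ff) (K0_countable : countable [set: K0])
    (K_algebraic : forall a : K, algebraicOver iota a)
    (charN_prime : forall p, p \in charN -> prime p)
    (charN_residue : forall p, residue_chars ff p -> p \in charN) :
  (exists phi : source ff iota C -> target ff iota C charN,
    [/\ forall (P : Xdot_Qin ff iota C) (u : Rpos R),
          phi (source_Q P u) = tw (tors_action ff iota C charN) (Qin_tors charN P) u,
        forall (p : charX0 ff) (P : Xdot_pin ff iota C (val p)) (u : Rpos R),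
          phi (source_p P u) = tw (tors_action ff iota C charN) (pin_tors charN P) u,
        forall (x : source ff iota C) (v : Rpos R),
          phi (source_scale x v) = tw_scale (phi x) v,
        continuous phi &
        bijective phi]) /\
  (exists phi : source0 ff iota C -> target0 ff iota C charN,
    [/\ forall (P : Xdot_Qin ff iota C) (u : Rpos R),
          phi (source0_Q (cls _ P) u) =
          tw (tors0_action ff iota C charN) (cls _ (Qin_tors charN P)) u,
        forall (p : charX0 ff) (P : Xdot_pin ff iota C (val p)) (u : Rpos R),
          phi (source0_p (cls _ P) u) =
          tw (tors0_action ff iota C charN) (cls _ (pin_tors charN P)) u,
        forall (x : source0 ff iota C) (v : Rpos R),
          phi (source0_scale x v) = tw_scale (phi x) v,
        continuous phi &
        bijective phi]).
Proof.
split.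
  have [phi [phiQ phip phiS phic phib]] :=
    decomposition_bijection R (in_decomposition iota C charN_residue).
  by exists phi.
have [phi [phiQ phip phiS phic phib]] :=
  decomposition_bijection R (in_decomposition0 iota C charN_residue).
exists phi; split=> //.
(* The induced map on orbits uses representatives; compatibility with the Galois action evaluates it
   on the class of P. *)
- move=> P u; rewrite [LHS]phiQ quot_mapE //; exact: orbit_map.
- move=> p P u; rewrite [LHS]phip quot_mapE //; exact: orbit_map.
Qed.
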